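(* Let $n\ge 3$ and let $W_n$ be the wheel with $n$ spokes, with its unique planar embedding $\mathbb{P}(W_n)$. Let $v_1,v_2,v_3$ be three distinct vertices, each of which is either a vertex of $W_n$ or a subdividing-vertex of $W_n$, and let $W_n+v$ be the graph obtained by performing these subdivisions and adding a new vertex $v\notin V(W_n)$ joined by edges to $v_1,v_2,v_3$ (so $v$ has degree three). Then the (minimum orientable) genus $\gamma(W_n+v)$ equals $0$ if $v_1,v_2,v_3$ all lie on the boundary of one face of $\mathbb{P}(W_n)$; otherwise $\gamma(W_n+v)=1$.
   Context: The wheel $W_n$ ($n\ge3$) is obtained from the $n$-cycle $C_n$ by adding a new vertex (the center) joined to all vertices of $C_n$; it is 3-connected and planar, so it has a unique planar embedding, denoted $\mathbb{P}(W_n)$. A subdividing-vertex of $W_n$ is a degree-two vertex inserted into an edge $e\in E(W_n)$ (subdividing $e$); such a vertex is regarded as lying on the boundary of every face of $\mathbb{P}(W_n)$ whose boundary contains $e$. The vertices $v_1,v_2,v_3$ are called the antennal vertices of $W_n+v$. The genus $\gamma(G)$ of a graph is the minimum $g$ such that $G$ embeds in the orientable surface of genus $g$. *)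

(* Defs.v *)
(* MathComp world. *)
From HB Require Import structures.
From mathcomp Require Import all_boot all_fingroup.

Set Implicit Arguments.
Unset Strict Implicit.
Unset Printing Implicit Defensive.

Record sgraph := SGraph {
  vertex :> finType;
  adj : rel vertex;
  adj_sym : symmetric adj;
  adj_irrefl : irreflexive adj }.

Definition dart (G : sgraph) : pred (G * G) := [pred d | adj d.1 d.2].
Arguments dart : clear implicits.

(* Each undirected edge is represented exactly once, by one of its two darts;
   the resulting orientation is only used to number subdividing vertices. *)
Definition edge (G : sgraph) : finType :=
  {d : G * G | adj d.1 d.2 && (enum_rank d.1 < enum_rank d.2)}.

Definition connected (G : sgraph) : Prop := forall x y : G, connect (@adj G) x y.

(* Embeddings in orientable surfaces are given combinatorially (Heffter-Edmonds):
   rho x y is the neighbour following y in the cyclic order around x.  The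
   values of rho x outside the neighbourhood of x are irrelevant. *)
Definition rotation_system (G : sgraph) (rho : G -> {perm G}) : Prop :=
  forall x y : G, adj x y -> porbit (rho x) y = [set z | adj x z].

(* Face tracing: after walking from x to y, continue to the neighbour of y
   that follows x around y.  The faces are the orbits of darts under this map. *)
Definition face_step (G : sgraph) (rho : G -> {perm G}) (d : G * G) : G * G :=
  (d.2, rho d.2 d.1).

(* rho describes a 2-cell embedding of G in the orientable surface of genus g
   (G having at least one edge): |V| - |E| + |F| = 2 - 2g. *)
Definition embedding (G : sgraph) (rho : G -> {perm G}) (g : nat) : Prop :=
  [/\ connected G, rotation_system rho
    & #|G| + fcard (face_step rho) (dart G) + 2 * g = #|edge G| + 2].

(* An embedding of a connected graph in the orientable surface of least
   possible genus is 2-cell, so minimizing over 2-cell embeddings loses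
   nothing. *)
Definition is_genus (G : sgraph) (g : nat) : Prop :=
  (exists rho : G -> {perm G}, embedding rho g) /\
  (forall (rho : G -> {perm G}) (g' : nat), embedding rho g' -> g <= g').

(* The wheel: None is the center, the rim vertices Some i form the n-cycle. *)
Definition wheel_adj (n : nat) : rel (option 'I_n) := fun x y =>
  match x, y with
  | None, None => false
  | Some i, Some j => (i != j) && ((j == ordS i) || (i == ordS j))
  | _, _ => true
  end.

Fact wheel_adj_sym n : symmetric (@wheel_adj n).
Proof. by move=> [i|] [j|] //=; rewrite eq_sym orbC. Qed.

Fact wheel_adj_irrefl n : irreflexive (@wheel_adj n).
Proof. by move=> [i|] //=; rewrite eqxx. Qed.

Definition wheel (n : nat) : sgraph :=
  SGraph (@wheel_adj_sym n) (@wheel_adj_irrefl n).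

(* Subdividing vertices when each edge e is subdivided k e times: the pair
   (e, i) is the i-th one on e, counted from the first endpoint of e. *)
Definition subdividing (G : sgraph) (k : edge G -> nat) : finType :=
  {e : edge G & 'I_(k e)}.

Definition subdiv_link (G : sgraph) (k : edge G -> nat) :
    rel (G + subdividing k)%type := fun a b =>
  match a, b with
  | inl x, inl y => [exists e : edge G, (val e == (x, y)) && (k e == 0)]
  | inl x, inr s => (x == (val (tag s)).1) && (nat_of_ord (tagged s) == 0)
  | inr s, inl y => (y == (val (tag s)).2) && ((nat_of_ord (tagged s)).+1 == k (tag s))
  | inr s, inr t =>
      (tag s == tag t) && ((nat_of_ord (tagged s)).+1 == nat_of_ord (tagged t))
  end.

Definition subdiv_adj (G : sgraph) (k : edge G -> nat) :
    rel (G + subdividing k)%type := fun a b =>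
  subdiv_link a b || subdiv_link b a.

Fact subdiv_adj_sym G k : symmetric (@subdiv_adj G k).
Proof. by move=> a b; rewrite /subdiv_adj orbC. Qed.

Fact subdiv_adj_irrefl G k : irreflexive (@subdiv_adj G k).
Proof.
move=> a; rewrite /subdiv_adj orbb; case: a => [x|s] /=.
  apply/existsP => -[[[u v] /= uv] /andP[/eqP[eq_u eq_v] _]].
  by rewrite eq_u eq_v ltnn andbF in uv.
by rewrite (gtn_eqF (ltnSn _)) andbF.
Qed.

Definition subdivision (G : sgraph) (k : edge G -> nat) : sgraph :=
  SGraph (@subdiv_adj_sym G k) (@subdiv_adj_irrefl G k).

Definition add_vertex_adj (G : sgraph) (S : {set G}) : rel (option G) :=
  fun x y =>
  match x, y with
  | None, None => false
  | Some a, Some b => adj a b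
  | None, Some b => b \in S
  | Some a, None => a \in S
  end.

Fact add_vertex_adj_sym G S : symmetric (@add_vertex_adj G S).
Proof. by move=> [a|] [b|] //=; rewrite adj_sym. Qed.

Fact add_vertex_adj_irrefl G S : irreflexive (@add_vertex_adj G S).
Proof. by move=> [a|] //=; rewrite adj_irrefl. Qed.

Definition add_vertex (G : sgraph) (S : {set G}) : sgraph :=
  SGraph (@add_vertex_adj_sym G S) (@add_vertex_adj_irrefl G S).

Definition vertex_on_face (G : sgraph) (rho : G -> {perm G}) (d : G * G)
    (x : G) : Prop :=
  exists y : G, fconnect (face_step rho) d (x, y).

Definition edge_on_face (G : sgraph) (rho : G -> {perm G}) (d : G * G)
    (e : edge G) : Prop :=
  fconnect (face_step rho) d (val e) \/
  fconnect (face_step rho) d ((val e).2, (val e).1).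

(* Incidence of a vertex of a subdivision of G with the face, of an embedding
   rho of G itself, that is traced from the dart d. *)
Definition on_face (G : sgraph) (rho : G -> {perm G}) (k : edge G -> nat)
    (d : G * G) (a : subdivision k) : Prop :=
  match a with
  | inl x => vertex_on_face rho d x
  | inr s => edge_on_face rho d (tag s)
  end.

Definition on_common_face (G : sgraph) (rho : G -> {perm G})
    (k : edge G -> nat) (a b c : subdivision k) : Prop :=
  exists d : G * G,
    [/\ d \in dart G, on_face rho d a, on_face rho d b & on_face rho d c].

(* Main.v *)
(** Euler counting on the wheel: every face through the centre uses one of the
    [n] corners there, and a face avoiding the centre runs around the whole rim,
    which forces all rim vertices to be oriented alike.  Hence a rotation system
    of the wheel has at most [n + 1] faces, and one with [n + 1] faces is the
    standard one or its mirror image.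

    Deleting [v] from a planar embedding leaves an embedding of the subdivided
    wheel with at least as many faces as a planar one, hence a planar one; each
    deletion of an edge at [v] must then have merged two distinct faces, so
    [v1], [v2], [v3] share a face.  Conversely, if they share a face of an
    embedding of genus [g], then [v] can be drawn in that face.  Every vertex
    and every edge of the wheel lies on a triangle through the centre, and
    exchanging three corners at the centre merges any three triangles into one
    face while raising the genus by one; this gives the torus embedding.

    Face counts are followed through the insertion and the deletion of an edge
    by multiplying the face permutation by two transpositions. *)
Require Import Defs.
From mathcomp Require Import all_boot all_fingroup.
From mathcomp Require Import zify.

Set Implicit Arguments.
Unset Strict Implicit.
Unset Printing Implicit Defensive.

(** * Orbits of a permutation multiplied by a transposition *)

(** Embeddings of different graphs have to be compared. Face tracing is therefore extended to all
    ordered pairs of vertices, and rotations are normalised to fix every non-neighbour: a non-edge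
    becomes a short orbit of its own, and graphs on the same vertex set have face permutations of
    the same type. For connected graphs Euler's formula then says that vertices plus orbits plus
    twice the genus is a constant that depends on the vertex set alone. To keep the vertex set
    fixed, [v] is present from the start as an isolated vertex. Its first edge costs one orbit,
    which pays for the additional vertex. Each further edge costs none if it joins two corners of
    one face, and otherwise two, that is, one handle. Read backwards, these costs bound the number
    of faces after deletion from below; the matching upper bound is the direct face count on the
    wheel. *)

Section PermOrbits.
Variable T : finType.
Implicit Types (s t : {perm T}) (x y z : T) (A : {set T}).
Local Open Scope group_scope.

Lemma porbit_eqP s x y : reflect (porbit s x = porbit s y) (x \in porbit s y).
Proof. by rewrite -eq_porbit_mem; apply: eqP. Qed.

Lemma porbit_trans s x y z :
  x \in porbit s y -> y \in porbit s z -> x \in porbit s z.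
Proof. by move=> xy /porbit_eqP <-. Qed.

Lemma porbit_step s x : porbit s (s x) = porbit s x.
Proof. exact: (porbit_perm s 1 x). Qed.

Lemma mem_porbit_step s x y : (s x \in porbit s y) = (x \in porbit s y).
Proof. by rewrite ![_ \in porbit s y]porbit_sym porbit_step. Qed.

Lemma porbit_closed s A x :
  (forall u, u \in A -> s u \in A) -> x \in A -> porbit s x \subset A.
Proof.
move=> sA xA; apply/subsetP=> _ /porbitP[i ->].
by elim: i => [|i IH]; rewrite ?expg0 ?perm1 // expgSr permM sA.
Qed.

Lemma porbit_fix s x : s x = x -> porbit s x = [set x].
Proof.
move=> sx; apply/eqP; rewrite eqEsubset sub1set porbit_id andbT.
by apply: porbit_closed => [u|]; rewrite !inE // => /eqP ->; rewrite sx.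
Qed.

Lemma fconnect_porbit s x y : fconnect s x y = (y \in porbit s x).
Proof.
apply/idP/porbitP => [/iter_findex <-|[i ->]]; last by rewrite permX fconnect_iter.
by exists (findex s x y); rewrite permX.
Qed.

Lemma fcardT_porbits s : fcard s T = #|porbits s|.
Proof.
rewrite /porbits [RHS](_ : _ = #|[set porbit s x | x in froots s]|).
  rewrite card_in_imset => [|x y].
    by apply: eq_card => x; rewrite !inE andbT.
  move=> xr yr /eqP; rewrite eq_porbit_mem -fconnect_porbit => yx.
  have /rootP -/(_ (fconnect_sym (@perm_inj _ s))) := yx.
  by rewrite (eqP xr) (eqP yr).
congr #|pred_of_set _|; apply/setP=> C.
apply/imsetP/imsetP=> -[x _ ->]; last by exists x.
exists (froot s x); first exact/roots_root/fconnect_sym/perm_inj.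
apply/porbit_eqP; rewrite -fconnect_porbit fconnect_sym ?connect_root //.
exact: perm_inj.
Qed.

(** The product sends [x] to [s y], runs through the [s]-cycle of [y] back to [y], and jumps from
    there to [s x]: the two cycles are spliced into one. *)
Lemma tperm_mul_join s x y :
  x \notin porbit s y ->
  porbit (tperm x y * s) x = porbit s x :|: porbit s y /\
  porbit (tperm x y * s) y = porbit s x :|: porbit s y.
Proof.
have sub a b : a \notin porbit s b ->
    porbit s b \subset porbit (tperm a b * s) a.
  move=> ab; set t := _ * s.
  have ta : t a = s b by rewrite permM tpermL.
  rewrite -(porbit_step s b); apply/subsetP=> u.
  suff: porbit s (s b) \subset porbit t a :&: porbit s b by move=> /subsetP h /h; case/setIP.
  apply: porbit_closed; last by rewrite inE -{1}ta !mem_porbit_step !porbit_id.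
  move=> v /setIP[va vb]; rewrite inE mem_porbit_step vb andbT.
  have [->|v'b] := eqVneq v b; first by rewrite -ta mem_porbit_step porbit_id.
  have v'a : v != a by apply: contraNneq ab => <-.
  rewrite (_ : s v = t v) ?mem_porbit_step // permM tpermD // eq_sym //.
move=> xy; have yx : y \notin porbit s x by rewrite porbit_sym.
have sy := sub _ _ xy; have sx := sub _ _ yx; rewrite tpermC in sx.
set t := _ * s in sx sy *.
have e : porbit t x = porbit t y.
  by apply/porbit_eqP; apply: (subsetP sx); apply: porbit_id.
have sU : porbit t x \subset porbit s x :|: porbit s y.
  apply: porbit_closed => [u|]; last by rewrite inE porbit_id.
  rewrite permM !inE !mem_porbit_step.
  by case: tpermP => [->|->|//]; rewrite !porbit_id ?orbT.
rewrite -e; suff -> : porbit t x = porbit s x :|: porbit s y by [].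
by apply/eqP; rewrite eqEsubset sU subUset sy e sx.
Qed.

Lemma tperm_mul_other s x y z :
  z \notin porbit s x -> z \notin porbit s y ->
  porbit (tperm x y * s) z = porbit s z.
Proof.
move=> zx zy; set t := _ * s.
have st u : u \in porbit s z -> t u = s u.
  move=> uz; rewrite permM tpermD //.
    by apply: contraNneq zx => ->; rewrite porbit_sym.
  by apply: contraNneq zy => ->; rewrite porbit_sym.
apply/eqP; rewrite eqEsubset; apply/andP; split.
  by apply: porbit_closed => [u uz|]; rewrite ?st ?mem_porbit_step ?porbit_id.
suff: porbit s z \subset porbit t z :&: porbit s z.
  by rewrite subsetI => /andP[].
apply: porbit_closed => [u|]; last by rewrite inE !porbit_id.
by rewrite !inE => /andP[ut us]; rewrite -{1}st // !mem_porbit_step ut.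
Qed.

(** The change in the number of cycles, read for [s] and for the product, forces [x] and [y] apart.
    Joining them again gives back [s], which identifies the union. *)
Lemma tperm_mul_split s x y :
  x != y -> x \in porbit s y ->
  porbit (tperm x y * s) x :|: porbit (tperm x y * s) y = porbit s x /\
  x \notin porbit (tperm x y * s) y.
Proof.
move=> xy xsy; have := porbits_mul_tperm (tperm x y * s) x y => /=.
have := porbits_mul_tperm s x y => /=; rewrite tpermKg xy xsy.
case E: (x \in porbit (tperm x y * s) y) => /= e1 e2; first by lia.
split=> //; have [] := @tperm_mul_join (tperm x y * s) x y; first by rewrite E.
by rewrite tpermKg => <-.
Qed.

Lemma card_porbits_join s x y :
  x \notin porbit s y -> #|porbits (tperm x y * s)|.+1 = #|porbits s|.
Proof.
move=> xy; have := porbits_mul_tperm s x y; rewrite /= xy.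
have -> : x != y by apply: contraNneq xy => ->; apply: porbit_id.
lia.
Qed.

Lemma card_porbits_split s x y :
  x != y -> x \in porbit s y -> #|porbits (tperm x y * s)| = #|porbits s|.+1.
Proof.
by move=> xy xsy; have := porbits_mul_tperm s x y; rewrite /= xsy xy; lia.
Qed.

Definition cyclic_on s A := {in A, forall x, porbit s x = A}.

(** The product sends [p] to [y] and [y] to the former successor of [p]. The alternative [p == y]
    with [A] empty is the first neighbour of an isolated vertex. *)
Lemma cyclic_on_insert s A y p :
  cyclic_on s A -> s y = y -> y \notin A -> (p \in A) || (p == y) && (A == set0) ->
  cyclic_on (tperm y p * s) (y |: A).
Proof.
move=> sA sy yA; have py := porbit_fix sy.
case/orP=> [pA|/andP[/eqP -> /eqP A0]]; last first.
  rewrite A0 setU0 tperm1 mul1g => x.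
  by rewrite inE => /eqP ->; rewrite py.
have ysp : y \notin porbit s p by rewrite sA.
have [ey _] := tperm_mul_join ysp; rewrite py sA // in ey.
by move=> x; rewrite -ey => /porbit_eqP ->.
Qed.

Lemma cyclic_on_delete s A y :
  cyclic_on s A -> y \in A ->
  cyclic_on (tperm y (s^-1 y) * s) (A :\ y) /\ (tperm y (s^-1 y) * s) y = y.
Proof.
move=> sA yA; set p := s^-1 y; set t := _ * s.
have ty : t y = y by rewrite permM tpermL permKV.
have py := porbit_fix ty.
split=> // x /setD1P[xy xA].
have pA : p \in porbit s y by rewrite -porbitV mem_porbit_step porbit_id.
have [e|yp] := eqVneq y p.
  have sy : s y = y by rewrite {1}e permKV.
  by move: xA; rewrite -(sA y yA) (porbit_fix sy) inE (negPf xy).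
have ysp : y \in porbit s p by rewrite porbit_sym.
have [] := tperm_mul_split yp ysp; rewrite -/t py sA // => e1 n.
have e2 : porbit t p = A :\ y.
  apply/setP=> u; rewrite -e1 !inE; case: eqP => //= ->; exact: negPf.
by apply/esym; rewrite -e2; apply/esym/porbit_eqP; rewrite e2 !inE xy.
Qed.

(** Fixing everything outside [A] is the normal form that makes the face permutation exchange
    [(x, y)] and [(y, x)] for a non-edge. *)
Definition rotates s A := cyclic_on s A /\ (forall y, y \notin A -> s y = y).

Lemma rotates_insert s A y p :
  rotates s A -> y \notin A -> (p \in A) || (p == y) && (A == set0) ->
  rotates (tperm y p * s) (y |: A).
Proof.
move=> [cA fA] yA pA; split; first by apply: cyclic_on_insert; rewrite ?fA.
move=> u; rewrite !inE negb_or => /andP[uy uA]; rewrite permM tpermD ?fA //.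
  by rewrite eq_sym.
case/orP: pA => [pA|/andP[/eqP-> _]]; last by rewrite eq_sym.
by apply: contraNneq uA => <-.
Qed.

Lemma rotates_delete s A y :
  rotates s A -> y \in A -> rotates (tperm y (s^-1 y) * s) (A :\ y).
Proof.
move=> [cA fA] yA; have [cA' fy] := cyclic_on_delete cA yA; split=> // u.
rewrite !inE negb_and negbK; have [-> //|uy /= uA] := eqVneq u y.
rewrite permM tpermD ?fA 1?eq_sym //.
by apply: contraNneq uy => e; rewrite -(fA u uA) e permKV.
Qed.

Lemma rotates_pred s A y :
  rotates s A -> y \in A -> (s^-1 y \in A) && ((s^-1 y == y) ==> (A == [set y])).
Proof.
move=> [cA fA] yA; apply/andP; split.
  by rewrite -(cA y yA) -porbitV mem_porbit_step porbit_id.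
apply/implyP=> /eqP e; have sy : s y = y by rewrite -{1}e permKV.
by rewrite -(porbit_fix sy) cA.
Qed.

End PermOrbits.

(** This carries the rotation at a vertex to a graph with another vertex type, along a bijection of
    neighbourhoods: the conjugate on [B], the identity elsewhere. *)
Lemma transport_cyclic (T U : finType) (h : T -> U) (h' : U -> T)
    (A : {set T}) (B : {set U}) (s : {perm T}) :
  {in A, forall a, h a \in B} -> {in B, forall b, h' b \in A} ->
  {in A, cancel h h'} -> {in B, cancel h' h} -> cyclic_on s A ->
  exists s' : {perm U},
    [/\ {in A, forall a, s' (h a) = h (s a)},
        {in [predC B], forall b, s' b = b} & cyclic_on s' B].
Proof.
move=> hB h'A hK h'K sA.
have sAA a : a \in A -> s a \in A.
  by move=> aA; rewrite -(sA a aA) mem_porbit_step porbit_id.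
pose f b := if b \in B then h (s (h' b)) else b.
have fB b : (f b \in B) = (b \in B).
  by rewrite /f; case: ifP => // bB; rewrite hB // sAA // h'A.
have f_inj : injective f.
  move=> b c e; have bc : (b \in B) = (c \in B) by rewrite -fB e fB.
  move: e; rewrite /f -bc; case: ifP => [bB e|//].
  have cB : c \in B by rewrite -bc.
  apply: (can_in_inj h'K) => //; apply: (@perm_inj _ s).
  by apply: (can_in_inj hK); rewrite ?sAA ?h'A.
exists (perm f_inj); split=> [a aA|b|b bB]; rewrite ?permE /f ?hB ?hK //.
  by rewrite inE => /negPf ->.
apply/eqP; rewrite eqEsubset; apply/andP; split.
  by apply: porbit_closed => // u uB; rewrite permE fB.
apply/subsetP=> c cB; rewrite -(h'K c) //.
have : h' c \in porbit s (h' b) by rewrite sA ?h'A.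
set t := perm _; suff: porbit s (h' b) \subset [set a in A | h a \in porbit t b].
  by move=> /subsetP sub /sub; rewrite inE => /andP[].
apply: porbit_closed => [u|]; rewrite inE ?h'A ?h'K ?porbit_id // !inE.
case/andP=> uA ut; rewrite sAA //= (_ : h (s u) = t (h u)) ?mem_porbit_step //.
by rewrite permE /f hB // hK.
Qed.

(** * Inserting an edge *)

(* In the face permutation, an absent edge is the orbit of its two darts [a] and
   [b]; inserting it after the darts [a'] and [b'] gives [psi] below. *)
Section EdgeSurgery.
Variables (D : finType) (phi : {perm D}) (a b a' b' : D).
Hypotheses (phia : phi a = b) (phib : phi b = a).
Local Open Scope group_scope.

Let porbit_ab : porbit phi b = [set a; b].
Proof.
apply/eqP; rewrite eqEsubset; apply/andP; split.
  apply: porbit_closed => [u|]; rewrite !inE ?eqxx ?orbT //.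
  by case/orP=> /eqP->; rewrite (phia, phib) eqxx ?orbT.
rewrite subUset !sub1set porbit_id andbT -phib mem_porbit_step; exact: porbit_id.
Qed.

(** The case of an isolated end, where [a'] is [a] and only one transposition is left: the orbit of
    the absent edge is absorbed by the face of [b']. *)
Lemma surgery_pendant :
  b' \notin [set a; b] ->
  #|porbits (tperm b b' * phi)|.+1 = #|porbits phi| /\
  porbit (tperm b b' * phi) b' = [set a; b] :|: porbit phi b'.
Proof.
rewrite -porbit_ab porbit_sym => bb'; split; first exact: card_porbits_join.
by case: (tperm_mul_join bb').
Qed.

Hypotheses (ab : a != b) (a'b' : a' != b').
Hypotheses (a'ab : a' \notin [set a; b]) (b'ab : b' \notin [set a; b]).

Let psi := tperm b b' * (tperm a a' * phi).
Let psi1 := tperm a a' * phi.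

Let aa' : a \notin porbit phi a'.
Proof.
rewrite porbit_sym; apply: contra a'ab.
by rewrite -[porbit phi a](porbit_step phi) phia porbit_ab.
Qed.

Let porbit1_a : porbit psi1 a' = [set a; b] :|: porbit phi a'.
Proof.
have [_ ->] := tperm_mul_join aa'.
by rewrite -porbit_ab -phib porbit_step.
Qed.

Let porbit1_b : porbit psi1 b = [set a; b] :|: porbit phi a'.
Proof. by rewrite -porbit1_a; apply/porbit_eqP; rewrite porbit1_a !inE eqxx orbT. Qed.

(** The first transposition absorbs the orbit of the absent edge into the face of [a']. As [b'] is
    in that face too, the second one cuts it in two and restores the count. The last two memberships
    record which corner lies in which half. *)
Lemma surgery_chord :
  b' \in porbit phi a' ->
  [/\ #|porbits psi| = #|porbits phi|,
      porbit psi b :|: porbit psi b' = [set a; b] :|: porbit phi a',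
      a' \in porbit psi b & a \in porbit psi b'].
Proof.
move=> b'a'.
have nbb' : b != b' by apply: contraNneq b'ab => <-; rewrite !inE eqxx orbT.
have bb' : b \in porbit psi1 b'.
  by rewrite porbit_sym porbit1_b inE b'a' orbT.
have [eU _] := tperm_mul_split nbb' bb'.
split.
- by rewrite card_porbits_split // card_porbits_join.
- by rewrite eU porbit1_b.
- rewrite (_ : b = psi a') ?porbit_step ?porbit_id // !permM [tperm b b' a']tpermD.
  + by rewrite tpermR.
  + by apply: contraNneq a'ab => <-; rewrite !inE eqxx orbT.
  + by rewrite eq_sym.
- rewrite (_ : a = psi b') ?mem_porbit_step ?porbit_id // !permM tpermR tpermD //.
  by apply: contraNneq a'ab => ->; rewrite !inE eqxx orbT.
Qed.

(** Here the second transposition fuses once more, and the two lost orbits amount to one handle. *)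
Lemma surgery_handle :
  b' \notin porbit phi a' -> #|porbits psi|.+2 = #|porbits phi|.
Proof.
move=> b'a'; rewrite card_porbits_join ?card_porbits_join //.
by rewrite porbit_sym porbit1_b inE negb_or b'ab.
Qed.

End EdgeSurgery.

(** * Face permutations on all ordered pairs of vertices *)

Section FacePerm.
Variable T : finType.
Implicit Types (rho : T -> {perm T}) (r : rel T).

Fact facep_subproof rho : injective (fun d : T * T => (d.2, rho d.2 d.1)).
Proof. by move=> [x y] [u v] /= [-> /perm_inj ->]. Qed.

(* Defined on all pairs rather than on darts, so that graphs with the same
   vertices have face permutations of the same type. *)
Definition facep rho : {perm T * T} := perm (@facep_subproof rho).

Lemma facepE rho x y : facep rho (x, y) = (y, rho y x).
Proof. by rewrite permE. Qed.

Definition rotation r rho := forall x, rotates (rho x) [set z | r x z].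

Lemma rotation_fix r rho x y : rotation r rho -> ~~ r x y -> rho x y = y.
Proof. by move=> /(_ x)[_ f] rxy; apply: f; rewrite inE. Qed.

Lemma rotation_adj r rho x y : rotation r rho -> r x (rho x y) = r x y.
Proof.
move=> rr; case rxy: (r x y); last by rewrite (rotation_fix rr) ?rxy.
have yA : y \in [set z | r x z] by rewrite inE.
have : rho x y \in porbit (rho x) y by rewrite mem_porbit_step porbit_id.
by have [cyc _] := rr x; rewrite (cyc _ yA) inE.
Qed.

Lemma rotation_ext r r' rho : r =2 r' -> rotation r rho -> rotation r' rho.
Proof.
move=> e rr x; rewrite (_ : [set z | r' x z] = [set z | r x z]) //.
by apply/setP=> z; rewrite !inE e.
Qed.

(** The diagonal is included: a non-adjacent pair [(x, x)] is an orbit of one element and counts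
    once as well. *)
Definition upairs := [set d : T * T | enum_rank d.1 <= enum_rank d.2].

(* A non-edge {x, y} contributes the orbit {(x, y), (y, x)}. *)
Lemma card_porbits_facep r rho : symmetric r -> rotation r rho ->
  #|porbits (facep rho)| =
    fcard (facep rho) [pred d | r d.1 d.2] +
    #|[set d in upairs | ~~ r d.1 d.2]|.
Proof.
move=> rs rr; rewrite -fcardT_porbits (n_compC [pred d : T * T | r d.1 d.2]).
congr (_ + _); set f := facep rho.
have fs : connect_sym (frel f) by exact/fconnect_sym/perm_inj.
have fN x y : ~~ r x y -> f (x, y) = (y, x).
  by move=> nxy; rewrite /f facepE (rotation_fix rr) // rs.
have orb d d' : ~~ r d.1 d.2 -> fconnect f d d' = (d' == d) || (d' == (d.2, d.1)).
  case: d => x y /= nxy; apply/idP/idP; last first.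
    case/orP=> /eqP->; first exact: connect0.
    by rewrite -(fN x y) // fconnect1.
  rewrite fconnect_porbit => h.
  have /subsetP/(_ _ h) : porbit f (x, y) \subset [set (x, y); (y, x)].
    apply: porbit_closed => [u|]; rewrite !inE ?eqxx //.
    by case/orP=> /eqP->; rewrite fN ?eqxx ?orbT // rs.
  by rewrite !inE.
set U := [set d in upairs | _]; rewrite -(card_in_imset (f := froot f) (D := mem U)).
  apply: eq_card => d; rewrite !inE; apply/andP/imsetP => [[dr nr]|].
    have [le|lt] := leqP (enum_rank d.1) (enum_rank d.2).
      by exists d; rewrite ?inE ?le ?(eqP dr).
    exists (d.2, d.1); first by rewrite !inE /= ltnW //= rs.
    by rewrite -{1}(eqP dr); apply/(rootP fs); rewrite orb // eqxx orbT.
  case=> d' /[!inE] /andP[le nr ->]; split; first exact: roots_root.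
  have : fconnect f d' (froot f d') by exact: connect_root.
  by rewrite orb // => /orP[]/eqP-> //=; rewrite rs.
move=> [x y] [u v] /[!inE] /= /andP[le nr] /andP[le' nr'] /rootP.
rewrite orb // => /(_ fs)/orP[/eqP //|/eqP [e1 e2]].
move: le le'; rewrite e1 e2 => le le'; congr (_, _); apply: enum_rank_inj;
by apply/val_inj/eqP; rewrite /= eqn_leq le le'.
Qed.

(* If [xy] is not an edge, [twist] inserts it, with [y] following [p] around [x]
   and [x] following [q] around [y] ([p = y] when [x] is isolated); if it is an
   edge and [p], [q] precede [y], [x] around [x], [y], then [twist] deletes it. *)
Definition twist rho x y p q := fun z =>
  if z == x then (tperm y p * rho x)%g
  else if z == y then (tperm x q * rho y)%g else rho z.

(** A pair [(u, x)] is mapped to [(x, rho x u)], so a transposition applied before the rotation at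
    [x] exchanges two pairs that arrive at [x]. *)
Lemma facep_twist rho x y p q : x != y ->
  facep (twist rho x y p q) =
    (tperm (y, x) (p, x) * (tperm (x, y) (q, y) * facep rho))%g.
Proof.
move=> xy; apply/permP=> -[u w]; rewrite !permM facepE /twist.
have tE (a b c e : T) :
    tperm (a, c) (b, c) (u, e) = (if e == c then tperm a b u else u, e).
  case: (eqVneq e c) => [->|ec].
    by case: (tpermP a b u) => [->|->|ua ub]; rewrite ?tpermL ?tpermR //;
       rewrite tpermD // xpair_eqE eqxx andbT eq_sym; apply/eqP.
  by rewrite tpermD // xpair_eqE negb_and eq_sym [c == e]eq_sym ec orbT.
rewrite tE; have [->|wx] := eqVneq w x.
  rewrite [tperm (x, y) _ _]tpermD ?facepE ?permM //;
  by rewrite xpair_eqE negb_and [y == x]eq_sym xy orbT.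
by rewrite /= tE; case: eqP => [->|_]; rewrite facepE ?permM.
Qed.

(** Transpositions are involutions; hence a deletion can be read as an insertion backwards, and the
    counts for insertion serve for both. *)
Lemma twistK rho x y p q : twist (twist rho x y p q) x y p q =1 rho.
Proof.
move=> z; rewrite /twist; case: (eqVneq z x) => [->|zx]; first by rewrite eqxx tpermKg.
case: (eqVneq z y) => [zy|//]; rewrite -zy eqxx (negPf zx); exact: tpermKg.
Qed.

Lemma eq_facep rho rho' : rho =1 rho' -> facep rho = facep rho'.
Proof. by move=> e; apply/permP=> -[x y]; rewrite !facepE e. Qed.

End FacePerm.

(** * Attaching the edges of the new vertex one at a time *)

Section AddVertex.
Variable H : sgraph.
Implicit Types (S : {set H}) (v p w : H) (rho : option H -> {perm option H}).

Local Notation rel_of S := (@add_vertex_adj H S).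

Lemma nbrs_insert S v x :
  [set z | rel_of (v |: S) x z] =
  if x == Some v then None |: [set z | rel_of S x z]
  else if x == None then Some v |: [set z | rel_of S x z]
  else [set z | rel_of S x z].
Proof.
apply/setP=> z; case: x => [x|] /=; last first.
  by rewrite !inE; case: z => [z|] //=; rewrite !inE.
have [[->]|nx] := eqVneq (Some x) (Some v); rewrite !inE.
  by case: z => [z|] /=; rewrite ?inE ?eqxx.
by case: z => [z|] //=; rewrite (_ : (x == v) = false) //; exact/negbTE.
Qed.

Lemma nbrs_delete S v x : v \in S ->
  [set z | rel_of (S :\ v) x z] =
  if x == Some v then [set z | rel_of S x z] :\ None
  else if x == None then [set z | rel_of S x z] :\ Some v
  else [set z | rel_of S x z].
Proof.
move=> vS; rewrite -{2 3 4}(setD1K vS) nbrs_insert.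
case: eqP => [->|_]; first by rewrite setU1K // inE /= !inE eqxx.
by case: eqP => [->|//]; rewrite setU1K // inE /= !inE eqxx.
Qed.

Lemma rotation_insert S v p q rho :
  rotation (rel_of S) rho -> v \notin S -> adj v p ->
  (if q is Some w then (w \in S) || (w == v) && (S == set0) else false) ->
  rotation (rel_of (v |: S)) (twist rho (Some v) None (Some p) q).
Proof.
move=> rr vS vp; case: q => // w wS x; rewrite nbrs_insert /twist.
case: eqP => [->|_]; first by apply: rotates_insert; rewrite ?inE /= ?vp.
case: eqP => [->|//]; apply: rotates_insert; rewrite ?inE //=.
case/orP: wS => [->//|/andP[/eqP-> /eqP->]]; rewrite eqxx andTb.
by apply/orP; right; apply/eqP/setP=> -[z|]; rewrite !inE //= inE.
Qed.

Lemma rotation_delete S v rho :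
  rotation (rel_of S) rho -> v \in S ->
  rotation (rel_of (S :\ v))
    (twist rho (Some v) None ((rho (Some v))^-1 None)%g ((rho None)^-1 (Some v))%g).
Proof.
move=> rr vS x; rewrite nbrs_delete // /twist.
case: eqP => [->|_]; first by apply: rotates_delete; rewrite // !inE.
by case: eqP => [->|//]; apply: rotates_delete; rewrite // !inE.
Qed.

Lemma insert_first v p rho :
  rotation (rel_of set0) rho -> adj v p ->
  let rho' := twist rho (Some v) None (Some p) (Some v) in
  let b' := (Some p, Some v) in
  #|porbits (facep rho')|.+1 = #|porbits (facep rho)| /\
  porbit (facep rho') b' =
    [set (Some v, None); (None, Some v)] :|: porbit (facep rho) b'.
Proof.
move=> rr vp rho' b'; rewrite facep_twist // tperm1 mul1g.
apply: surgery_pendant.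
- by rewrite facepE (rotation_fix rr) //= inE.
- by rewrite facepE (rotation_fix rr) //= inE.
- by rewrite !inE !xpair_eqE /= andbF.
Qed.

(** A corner is named by the dart arriving at it: [b'] is the corner at [v] after [p], and [a'] the
    corner at the new vertex after [w]. The test asks whether both belong to one face. *)
Lemma insert_chord S v p w rho :
  rotation (rel_of S) rho -> v \notin S -> adj v p -> w \in S ->
  let rho' := twist rho (Some v) None (Some p) (Some w) in
  let a := (Some v, None) in let b := (None, Some v) in
  let a' := (Some w, None) in let b' := (Some p, Some v) in
  if b' \in porbit (facep rho) a' then
    [/\ #|porbits (facep rho')| = #|porbits (facep rho)|,
        porbit (facep rho') b :|: porbit (facep rho') b' =
          [set a; b] :|: porbit (facep rho) a',
        a' \in porbit (facep rho') b & a \in porbit (facep rho') b']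
  else #|porbits (facep rho')|.+2 = #|porbits (facep rho)|.
Proof.
move=> rr vS vp wS rho' a b a' b'; rewrite facep_twist //.
have vw : v != w by apply: contraNneq vS => ->.
have pa : facep rho a = b by rewrite facepE (rotation_fix rr).
have pb : facep rho b = a by rewrite facepE (rotation_fix rr).
have a'ab : a' \notin [set a; b].
  by apply/negP; rewrite !inE => /orP[]/eqP // -[e]; rewrite e eqxx in vw.
have b'ab : b' \notin [set a; b] by apply/negP; rewrite !inE => /orP[]/eqP.
have ab : a != b by apply/eqP.
have a'b' : a' != b' by apply/eqP.
by case: ifP => [h|/negbT h]; [apply: surgery_chord|apply: surgery_handle].
Qed.

Lemma rotation_add3 v1 v2 v3 p1 p2 p3 rho :
  rotation (rel_of set0) rho ->
  [/\ v1 != v2, v1 != v3 & v2 != v3] -> [/\ adj v1 p1, adj v2 p2 & adj v3 p3] ->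
  (Some p2, Some v2) \in porbit (facep rho) (Some p1, Some v1) ->
  (Some p3, Some v3) \in porbit (facep rho) (Some p1, Some v1) ->
  exists2 rho', rotation (rel_of [set v1; v2; v3]) rho' &
    #|porbits (facep rho')|.+1 = #|porbits (facep rho)|.
Proof.
move=> rr [v12 v13 v23] [vp1 vp2 vp3] h2 h3.
have [n1 o1] := insert_first rr vp1.
have rr1 : rotation (rel_of (v1 |: set0)) (twist rho (Some v1) None (Some p1) (Some v1)).
  by apply: rotation_insert; rewrite ?inE ?eqxx.
set rho1 := twist _ _ _ _ _ in n1 o1 rr1.
have h1 u : u \in porbit (facep rho) (Some p1, Some v1) ->
    u \in porbit (facep rho1) (Some v1, None).
  move=> hu; rewrite (porbit_eqP _ _ _ _ : _ = porbit (facep rho1) (Some p1, Some v1)) o1 !inE.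
    by rewrite hu !orbT.
  by rewrite eqxx.
have v2S : v2 \notin v1 |: set0 by rewrite !inE orbF eq_sym.
have := @insert_chord _ v2 p2 v1 _ rr1 v2S vp2; rewrite /= h1 // => -[].
  by rewrite !inE eqxx.
have rr2 : rotation (rel_of (v2 |: (v1 |: set0)))
    (twist rho1 (Some v2) None (Some p2) (Some v1)).
  by apply: rotation_insert; rewrite ?inE ?eqxx // orbF eq_sym.
set rho2 := twist _ _ _ _ _ in rr2 *.
move=> n2 U2 hb hb'.
pose S := v2 |: (v1 |: set0).
(* The second edge cuts the face in two, and each half has a corner at the new vertex, after [v1] or
   after [v2]. The third edge uses the one in the half that contains the corner of [v3]. *)
have {}h3 : exists2 w, w \in S &
    (Some p3, Some v3) \in porbit (facep rho2) (Some w, None).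
  have : (Some p3, Some v3) \in [set (Some v2, None); (None, Some v2)]
      :|: porbit (facep rho1) (Some v1, None) by rewrite inE h1 ?orbT.
  rewrite -U2 inE => /orP[] h; [exists v1|exists v2]; rewrite ?inE ?eqxx ?orbT //.
    by rewrite (porbit_eqP _ _ _ hb).
  by rewrite (porbit_eqP _ _ _ hb').
case: h3 => w wS hw.
have v3S : v3 \notin S by rewrite !inE orbF negb_or ![v3 == _]eq_sym v13 v23.
have := @insert_chord _ v3 p3 w _ rr2 v3S vp3 wS; rewrite /= hw => -[n3 _ _ _].
have rr3 := @rotation_insert _ v3 p3 (Some w) _ rr2 v3S vp3 _.
exists (twist rho2 (Some v3) None (Some p3) (Some w)); last by rewrite n3 n2.
apply: rotation_ext (rr3 _); last by rewrite wS.
suff -> : v3 |: S = [set v1; v2; v3] by [].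
by apply/setP=> z; rewrite !inE orbF; do 3!case: (z == _).
Qed.

Lemma rotation_remove S v u rho :
  rotation (rel_of (v |: S)) rho -> v \notin S -> adj v u ->
  exists p w rho',
    [/\ adj v p, (w \in S) || (w == v) && (S == set0), rotation (rel_of S) rho' &
      facep rho = facep (twist rho' (Some v) None (Some p) (Some w))].
Proof.
move=> rr vS vu.
set p := ((rho (Some v))^-1 None)%g; set q := ((rho None)^-1 (Some v))%g.
have rr' := rotation_delete rr (setU11 v S); rewrite -/p -/q setU1K // in rr'.
have eqf := eq_facep (fsym (@twistK _ rho (Some v) None p q)).
have := @rotates_pred _ _ _ None (rr (Some v)).
rewrite -/p ![_ \in [set _ | _]]inE /= setU11 => /(_ isT).
have := @rotates_pred _ _ _ (Some v) (rr None).
rewrite -/q ![_ \in [set _ | _]]inE /= setU11 => /(_ isT).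
case: q rr' eqf => [w|]; last by [].
(* If [None] preceded itself, it would be the only neighbour of [Some v]; but [u] is another one. *)
case: p => [p|] rr' eqf; last first.
  move=> _ /andP[_ /= /eqP/setP/(_ (Some u))].
  by rewrite !inE /= vu.
move=> /andP[wS wv] /andP[vp _]; exists p, w, (twist rho (Some v) None (Some p) (Some w)).
split=> //; move: wS wv; rewrite !inE; case: eqP => [->|_] /=; last by move=> ->.
rewrite eqxx /= => _ /eqP S1; apply/orP; right; apply/eqP/setP=> z.
rewrite inE; apply/negP=> zS; move/setP/(_ (Some z)): S1; rewrite !inE zS orbT.
by move=> /esym/eqP[zv]; rewrite zv (negPf vS) in zS.
Qed.

(** Reinserting the edges at [v3], [v2], [v1] costs one orbit, then zero or two each. A total cost
    of one makes the last two edges chords, which puts the three corners in one face. *)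
Lemma rotation_remove3 v1 v2 v3 rho :
  (forall v, exists u, @adj H v u) ->
  [/\ v1 != v2, v1 != v3 & v2 != v3] ->
  rotation (rel_of [set v1; v2; v3]) rho ->
  exists rho0, [/\ rotation (rel_of set0) rho0,
    #|porbits (facep rho)| < #|porbits (facep rho0)| &
    #|porbits (facep rho0)| <= #|porbits (facep rho)|.+1 ->
    exists p1 p2 p3, [/\ adj v1 p1, adj v2 p2, adj v3 p3,
      (Some p1, Some v1) \in porbit (facep rho0) (Some p3, Some v3) &
      (Some p2, Some v2) \in porbit (facep rho0) (Some p3, Some v3)]].
Proof.
move=> nbr [v12 v13 v23] rr.
have [u1 vu1] := nbr v1; have [u2 vu2] := nbr v2; have [u3 vu3] := nbr v3.
have S1 : v3 \notin set0 by rewrite inE.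
have S2 : v2 \notin v3 |: set0 by rewrite !inE orbF.
have S3 : v1 \notin v2 |: (v3 |: set0) by rewrite !inE orbF negb_or v12.
have {}rr : rotation (rel_of (v1 |: (v2 |: (v3 |: set0)))) rho.
  suff -> : v1 |: (v2 |: (v3 |: set0)) = [set v1; v2; v3] by [].
  by apply/setP=> z; rewrite !inE orbF orbA.
have [p1 [w1 [rho1 [vp1 w1S rr1 e1]]]] := rotation_remove rr S3 vu1.
have [p2 [w2 [rho2 [vp2 w2S rr2 e2]]]] := rotation_remove rr1 S2 vu2.
have [p3 [w3 [rho3 [vp3 w3S rr3 e3]]]] := rotation_remove rr2 S1 vu3.
have w1E : (w1 == v2) || (w1 == v3).
  case/orP: w1S => [|/andP[_ /eqP/setP/(_ v2)]]; first by rewrite !inE orbF.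
  by rewrite !inE eqxx.
have {}w2S : w2 = v3.
  case/orP: w2S => [|/andP[_ /eqP/setP/(_ v3)]]; first by rewrite !inE orbF => /eqP.
  by rewrite !inE eqxx.
have {}w3S : w3 = v3 by move: w3S; rewrite inE eqxx andbT /= => /eqP.
subst w2 w3; exists rho3.
have [] := insert_first rr3 vp3; rewrite -e3 => n3 o3.
(* One or two handles among the last two insertions make the loss 3 or 5, against the 1 allowed. *)
have arith m : (m < m.+3) * (m < m.+3.+2) * ((m.+3 <= m.+1) = false)
  * ((m.+3.+2 <= m.+1) = false) by elim: m.
have := insert_chord rr2 S2 vp2 (setU11 _ _); rewrite /= -e2.
have {}w1S : w1 \in v2 |: (v3 |: set0) by rewrite !inE orbF.
have := insert_chord rr1 S3 vp1 w1S; rewrite /= -e1.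
case: ifP => [h1 [n1 _ _ _]|_ n1]; last first.
  by case: ifP => _; [case=> n2 _ _ _|move=> n2]; split=> //; rewrite -n3 ?n2 -?n2 -n1 arith.
case: ifP => [h2 [n2 U2 a2 b2]|_ n2]; last by split=> //; rewrite -n3 -n2 n1 arith.
split=> //; first by rewrite -n3 -n2 n1.
move=> _; exists p1, p2, p3; split=> //.
  (* The corner of [v1] lies in one of the halves cut by the edge at [v2]. By [U2] it was already in
     the face before the cut, since neither dart of that edge is a corner at [v1]. *)
  have : (Some p1, Some v1) \in porbit (facep rho1) (None, Some v2)
      :|: porbit (facep rho1) (Some p2, Some v2).
    case/orP: w1E => /eqP ew; rewrite ew in h1; rewrite inE.
      by rewrite (porbit_eqP _ _ _ b2) in h1; rewrite h1 orbT.
    by rewrite (porbit_eqP _ _ _ a2) in h1; rewrite h1.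
  rewrite U2 inE => /orP[]; first by rewrite !inE => /orP[]/eqP.
  have -> : porbit (facep rho2) (Some v3, None) = porbit (facep rho2) (Some p3, Some v3).
    by apply/porbit_eqP; rewrite o3 !inE eqxx.
  by rewrite o3 inE => /orP[|//]; rewrite !inE => /orP[]/eqP.
move: h2; have -> : porbit (facep rho2) (Some v3, None) = porbit (facep rho2) (Some p3, Some v3).
  by apply/porbit_eqP; rewrite o3 !inE eqxx.
by rewrite o3 inE => /orP[|//]; rewrite !inE => /orP[]/eqP.
Qed.

End AddVertex.

(** * Euler's formula in terms of orbits *)

Section Sgraph.
Variable G : sgraph.
Implicit Types (rho : G -> {perm G}) (d : G * G).

Lemma face_stepE rho : face_step rho =1 facep rho.
Proof. by move=> [x y]; rewrite facepE. Qed.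

Lemma face_step_sym rho : connect_sym (frel (face_step rho)).
Proof. by apply/fconnect_sym => -[x y] [u v] [-> /perm_inj->]. Qed.

Lemma fconnect_face_step rho d d' :
  fconnect (face_step rho) d d' = (d' \in porbit (facep rho) d).
Proof. by rewrite (eq_fconnect (face_stepE rho)) fconnect_porbit. Qed.

Lemma fcard_face_step rho :
  fcard (face_step rho) (dart G) = fcard (facep rho) [pred d | adj d.1 d.2].
Proof. exact: (eq_fcard (face_stepE rho)). Qed.

Lemma rotation_rotation_system rho : rotation (@adj G) rho -> rotation_system rho.
Proof. by move=> rr x y xy; have [c _] := rr x; apply: c; rewrite inE. Qed.

(** A rotation system is free outside neighbourhoods; resetting those values to fixed points leaves
    the faces alone, as [fcard_agree] shows. *)
Lemma rotation_normalize rho : rotation_system rho ->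
  exists2 rho', rotation (@adj G) rho' & forall x y, adj x y -> rho' x y = rho x y.
Proof.
move=> rs.
have /fin_all_exists[rho' h] x : exists s : {perm G},
    rotates s [set z | adj x z] /\ (forall y, adj x y -> s y = rho x y).
  pose A := [set z | adj x z].
  have cA : cyclic_on (rho x) A by move=> y; rewrite inE; exact: rs.
  have [s [e f c]] := @transport_cyclic _ _ id id A A (rho x)
    (fun _ h => h) (fun _ h => h) (in1W (frefl _)) (in1W (frefl _)) cA.
  by exists s; split=> [|y xy]; [split=> // y; apply: f|apply: e; rewrite inE].
by exists rho' => [x|x y]; have [] := h x => // _; apply.
Qed.

Lemma face_step_dart rho d : rotation_system rho ->
  (face_step rho d \in dart G) = (d \in dart G).
Proof.
case: d => x y rs; rewrite !inE /= [RHS]adj_sym.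
apply/idP/idP=> [h|yx].
  have /setP/(_ x) := rs _ _ h.
  by rewrite inE -(mem_porbit_step (rho y)) porbit_id => <-.
have /setP/(_ (rho y x)) := rs _ _ yx.
by rewrite mem_porbit_step porbit_id inE => <-.
Qed.

Section Agree.
Variables (rho rho' : G -> {perm G}).
Hypothesis rs : rotation_system rho.
Hypothesis agree : forall x y, adj x y -> rho' x y = rho x y.

Lemma fconnect_agree d d' : d \in dart G ->
  fconnect (face_step rho') d d' = fconnect (face_step rho) d d'.
Proof.
move=> dG.
have it i : iter i (face_step rho') d = iter i (face_step rho) d
    /\ iter i (face_step rho) d \in dart G.
  elim: i => [//|i [IH IG]] /=; rewrite face_step_dart // IG IH; split=> //.
  case: (iter i _ d) IG => x y; rewrite inE /= => xy.
  by rewrite /face_step /= agree // adj_sym.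
by apply/idP/idP=> /iter_findex <-; [rewrite (it _).1|rewrite -(it _).1];
   rewrite fconnect_iter.
Qed.

Lemma fcard_agree :
  fcard (face_step rho') (dart G) = fcard (face_step rho) (dart G).
Proof.
apply: eq_card => d; rewrite !inE /=; case dG: (adj d.1 d.2); rewrite ?andbF //.
rewrite !andbT /roots /root (@eq_pick _ _ (connect (frel (face_step rho)) d)) //.
by move=> d'; apply: fconnect_agree.
Qed.

End Agree.

(* With the vertices fixed, Euler's formula thus no longer mentions the edges:
   [#|G| + #|porbits (facep rho)| + 2 * g = #|upairs G| + 2]. *)
Lemma card_edge_porbits rho : rotation (@adj G) rho ->
  #|edge G| + #|porbits (facep rho)| =
    fcard (face_step rho) (dart G) + #|upairs G|.
Proof.
move=> rr; rewrite (card_porbits_facep (@adj_sym G) rr) fcard_face_step.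
rewrite addnCA; congr (_ + _); rewrite card_sig.
rewrite -(cardsID [set d | adj d.1 d.2] (upairs G)); congr (_ + _).
  apply: eq_card => -[x y]; rewrite !inE /= andbC; case xy: (adj x y); rewrite ?andbF //.
  rewrite !andbT ltn_neqAle andb_idl // => _; apply: contraTneq xy => /val_inj/enum_rank_inj->.
  by rewrite adj_irrefl.
by apply: eq_card => -[x y]; rewrite !inE andbC.
Qed.

Lemma card_dart_edge : #|dart G| = #|edge G|.*2.
Proof.
rewrite -addnn -(cardID [pred d : G * G | enum_rank d.1 < enum_rank d.2]) card_sig.
congr (_ + _).
have inj : injective (fun d : G * G => (d.2, d.1)) by move=> [x y] [u v] [-> ->].
rewrite -[RHS](card_image inj); apply: eq_card => -[x y]; rewrite !inE /=.
apply/idP/imageP=> [/andP[lt xy]|[[u v] /[!inE] /= /andP[vu lt] [-> ->]]].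
  exists (y, x) => //; rewrite !inE /= adj_sym xy /= ltn_neqAle leqNgt lt andbT.
  by apply: contraTneq xy => /val_inj/enum_rank_inj->; rewrite adj_irrefl.
by rewrite adj_sym vu -leqNgt ltnW.
Qed.

End Sgraph.

(** * Adjoining an isolated vertex *)

Section IsolatedVertex.
Variable H : sgraph.
Local Notation H0 := (@add_vertex H set0).

Lemma card_edge_isolated : #|edge H0| = #|edge H|.
Proof.
apply: double_inj; rewrite -!card_dart_edge.
have inj : injective (fun d : H * H => (Some d.1, Some d.2)).
  by move=> [x y] [u v] /= [-> ->].
rewrite -[RHS](card_image inj); apply: eq_card => -[x y].
apply/idP/imageP=> [|[[u v] uv [-> ->]] //].
case: x y => [x|] [y|]; rewrite inE /= ?inE //.
by exists (x, y).
Qed.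

Section Restrict.
Variables (rho : H -> {perm H}) (rho0 : H0 -> {perm H0}).
Hypotheses (rr : rotation (@adj H) rho) (rr0 : rotation (@adj H0) rho0).
Hypothesis rhoE : forall x y, adj x y -> rho0 (Some x) (Some y) = Some (rho x y).

Let h (d : H * H) : H0 * H0 := (Some d.1, Some d.2).

(** The isolated vertex carries no dart, so a trace that starts in [H] never leaves the image of
    [h]. *)
Lemma isolated_porbit d d' : d \in dart H ->
  (h d' \in porbit (facep rho0) (h d)) = (d' \in porbit (facep rho) d).
Proof.
move=> dH.
have it i : iter i (facep rho0) (h d) = h (iter i (facep rho) d)
    /\ iter i (facep rho) d \in dart H.
  elim: i => [//|i [IH IG]] /=; rewrite {}IH.
  case: (iter i _ d) IG => x y; rewrite !facepE !inE /= => xy.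
  by rewrite rhoE 1?adj_sym // adj_sym (rotation_adj _ _ rr) adj_sym.
have h_inj : injective h by move=> [x y] [u v] [-> ->].
apply/porbitP/porbitP=> -[i]; rewrite permX.
  by rewrite (it i).1 => /h_inj ->; exists i; rewrite permX.
by move=> ->; exists i; rewrite permX (it i).1.
Qed.

Lemma isolated_fcard :
  fcard (face_step rho0) (dart H0) = fcard (face_step rho) (dart H).
Proof.
have cl : fclosed (face_step rho0) (dart H0).
  move=> d _ /eqP<-; rewrite face_step_dart //; exact: rotation_rotation_system.
rewrite (adjunction_n_comp h (@face_step_sym _ _) (@face_step_sym _ rho) cl).
  by apply: eq_n_comp_r => d; rewrite !inE.
split=> [[[x|] [y|]] xy|d d' dH]; try by rewrite inE /= ?inE in xy.
  by exists (x, y); apply: connect0.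
by rewrite !fconnect_face_step isolated_porbit.
Qed.

Lemma isolated_card_porbits :
  #|edge H| + #|porbits (facep rho0)| =
    fcard (face_step rho) (dart H) + #|upairs H0|.
Proof. by rewrite -card_edge_isolated card_edge_porbits // isolated_fcard. Qed.

End Restrict.

Lemma rotation_isolate rho : rotation (@adj H) rho ->
  exists2 rho0, rotation (@adj H0) rho0 &
    forall x y, adj x y -> rho0 (Some x) (Some y) = Some (rho x y).
Proof.
move=> rr.
have hx (x : H) : exists s : {perm H0}, rotates s [set z | @adj H0 (Some x) z]
    /\ (forall y, adj x y -> s (Some y) = Some (rho x y)).
  have [] := @transport_cyclic _ _ Some (odflt x) [set z | adj x z]
    [set z | @adj H0 (Some x) z] (rho x).
  - by move=> a; rewrite !inE.
  - by move=> [b|]; rewrite !inE //= inE.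
  - by [].
  - by move=> [b|]; rewrite !inE //= inE.
  - by have [] := rr x.
  move=> s [e f c]; exists s; split=> [|y xy]; last by apply: e; rewrite inE.
  by split=> // y; apply: f.
have /fin_all_exists[rho0 r0] (x : H0) : exists s : {perm H0},
    rotates s [set z | @adj H0 x z] /\
    (if x is Some x' then forall y, adj x' y -> s (Some y) = Some (rho x' y) else True).
  case: x => [x|]; first exact: hx.
  exists 1%g; do 2!split=> //; last by move=> y _; rewrite perm1.
  by move=> [y|]; rewrite !inE //= inE.
by exists rho0 => [x|x y]; [have [] := r0 x|have [_] := r0 (Some x); apply].
Qed.

Lemma rotation_forget rho0 : rotation (@adj H0) rho0 ->
  exists2 rho, rotation (@adj H) rho &
    forall x y, adj x y -> rho0 (Some x) (Some y) = Some (rho x y).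
Proof.
move=> rr.
have /fin_all_exists[rho r0] (x : H) : exists s : {perm H},
    rotates s [set z | adj x z] /\
    (forall y, adj x y -> rho0 (Some x) (Some y) = Some (s y)).
  have [] := @transport_cyclic _ _ (odflt x) Some [set z | @adj H0 (Some x) z]
    [set z | adj x z] (rho0 (Some x)).
  - by move=> [b|]; rewrite !inE //= inE.
  - by move=> a; rewrite !inE.
  - by move=> [b|]; rewrite !inE //= inE.
  - by [].
  - by have [] := rr (Some x).
  move=> s [e f c]; exists s; split=> [|y xy]; first by split=> // y; apply: f.
  have := e (Some y); rewrite inE /= xy => -> //.
  have := rotation_adj (Some x) (Some y) rr; rewrite /= xy.
  by case: (rho0 _ _) => //=; rewrite inE.
by exists rho => [x|x y]; have [] := r0 x => // _; apply.
Qed.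

End IsolatedVertex.

(** * Embeddings before and after adding the vertex *)

Section AddVertexEmbedding.
Variables (H : sgraph) (v1 v2 v3 : H).
Hypothesis v123 : [/\ v1 != v2, v1 != v3 & v2 != v3].
Let S := [set v1; v2; v3].

(** One vertex more against one orbit less: the genus stays that of [rho]. *)
Lemma embedding_add_vertex (rho : H -> {perm H}) g p1 p2 p3 :
  connected H -> rotation (@adj H) rho ->
  #|H| + fcard (face_step rho) (dart H) + 2 * g = #|edge H| + 2 ->
  [/\ adj v1 p1, adj v2 p2 & adj v3 p3] ->
  fconnect (face_step rho) (p1, v1) (p2, v2) ->
  fconnect (face_step rho) (p1, v1) (p3, v3) ->
  exists rho' : add_vertex S -> {perm add_vertex S}, embedding rho' g.
Proof.
move=> cH rr eul [vp1 vp2 vp3]; rewrite !fconnect_face_step => h2 h3.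
have [rho0 rr0 rE] := rotation_isolate rr.
have p1H : (p1, v1) \in dart H by rewrite inE /= adj_sym.
have [] := @rotation_add3 H v1 v2 v3 p1 p2 p3 rho0 rr0 v123.
- by split.
- by have := isolated_porbit rr rE (p2, v2) p1H; rewrite h2.
- by have := isolated_porbit rr rE (p3, v3) p1H; rewrite h3.
move=> rho' rr' nE; exists rho'; split.
- have toN (x : H) : connect (@adj (add_vertex S)) (Some x) (Some v1).
    have /connectP[p xp ->] := cH x v1.
    apply/connectP; exists (map Some p); last by rewrite last_map.
    by rewrite (map_path (e' := @adj H) (b := pred0)) //; apply/hasP => -[].
  have v1N : connect (@adj (add_vertex S)) (Some v1) None.
    by apply: connect1; rewrite /= !inE eqxx.
  have toN' (x : add_vertex S) : connect (@adj (add_vertex S)) x None.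
    by case: x => [x|//]; apply: connect_trans (toN x) v1N.
  have cs : connect_sym (@adj (add_vertex S)) by apply: sym_connect_sym; exact: adj_sym.
  by move=> x y; apply: connect_trans (toN' x) _; rewrite cs.
- exact: (@rotation_rotation_system (add_vertex S)).
have eE := isolated_card_porbits rr rr0 rE.
have := @card_edge_porbits (add_vertex S) rho' rr'.
have {}nE : #|porbits (@facep (add_vertex S) rho')|.+1 =
    #|porbits (@facep (add_vertex set0) rho0)| := nE.
(* Pairs depend only on the vertex type, which is the same for every attachment set. *)
have -> : #|upairs (add_vertex S)| = #|upairs (add_vertex (set0 : {set H}))| := erefl.
have -> : #|add_vertex S| = #|H|.+1 := card_option H.
move: nE eE eul; clear; lia.
Qed.

(** Deletion gains at least one orbit, whence the lower bound on the faces. The last clause waits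
    for the opposite bound; for the wheel it comes from counting faces. *)
Lemma embedding_remove_vertex (rho : add_vertex S -> {perm add_vertex S}) :
  (forall v, exists u, @adj H v u) -> embedding rho 0 ->
  exists rho0 : H -> {perm H},
    [/\ rotation (@adj H) rho0,
      #|edge H| + 2 <= #|H| + fcard (face_step rho0) (dart H) &
      #|H| + fcard (face_step rho0) (dart H) <= #|edge H| + 2 ->
      exists p1 p2 p3, [/\ adj v1 p1, adj v2 p2, adj v3 p3,
        fconnect (face_step rho0) (p3, v3) (p1, v1) &
        fconnect (face_step rho0) (p3, v3) (p2, v2)]].
Proof.
move=> nbr [_ rs eul].
have [rho' rr agree] := @rotation_normalize (add_vertex S) rho rs.
have eE := @card_edge_porbits (add_vertex S) rho' rr.
rewrite (@fcard_agree (add_vertex S) rho rho' rs agree) in eE.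
have [rho1 [rr1 lt1 cof]] := @rotation_remove3 H v1 v2 v3 rho' nbr v123 rr.
have [rho0 rr0 rE] := rotation_forget rr1.
have eE0 := isolated_card_porbits rr0 rr1 rE.
have eV : #|add_vertex S| = #|H|.+1 := card_option H.
have eU : #|upairs (add_vertex S)| = #|upairs (add_vertex (set0 : {set H}))| := erefl.
rewrite eV in eul; rewrite eU in eE.
have {}lt1 : #|porbits (@facep (add_vertex S) rho')| <
    #|porbits (@facep (add_vertex set0) rho1)| := lt1.
exists rho0; split=> //; first by move: eul eE eE0 lt1; clear; lia.
move=> le; have {cof} [|p1 [p2 [p3 [vp1 vp2 vp3 h1 h2]]]] := cof.
  change (#|porbits (@facep (add_vertex set0) rho1)| <=
    #|porbits (@facep (add_vertex S) rho')|.+1).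
  by move: le eul eE eE0; clear; lia.
have p3H : (p3, v3) \in dart H by rewrite inE /= adj_sym.
exists p1, p2, p3; split; rewrite ?fconnect_face_step //.
  by have := isolated_porbit rr0 rE (p1, v1) p3H; rewrite h1.
by have := isolated_porbit rr0 rE (p2, v2) p3H; rewrite h2.
Qed.

End AddVertexEmbedding.

(** * Subdivisions *)

Section Subdivision.
Variables (G : sgraph) (k : edge G -> nat).
Local Notation H := (subdivision k).

Definition swap (T : Type) (d : T * T) := (d.2, d.1).

(* The path replacing [e] is [sub_pt e 0], ..., [sub_pt e (k e).+1]; larger
   indices give its last vertex again. *)
Definition sub_pt (e : edge G) (j : nat) : H :=
  if j is i.+1 then
    if (insub i : option 'I_(k e)) is Some o then inr (Tagged (fun e => 'I_(k e)) o) else inl (val e).2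
  else inl (val e).1.

#[local] Arguments sub_pt : simpl never.

Definition sub_pos (e : edge G) (a : H) : nat :=
  match a with
  | inl x => if x == (val e).1 then 0 else (k e).+1
  | inr s => (tagged s).+1
  end.

(* The dart of [G] whose path contains [d]; meaningful only when [d] is a dart. *)
Definition sub_dart (d : H * H) : G * G :=
  match d with
  | (inl x, inl y) => (x, y)
  | (inl x, inr s) => let e := val (tag s) in if x == e.1 then e else swap e
  | (inr s, inl y) => let e := val (tag s) in if y == e.2 then e else swap e
  | (inr s, inr t) =>
      let e := val (tag s) in if tagged s < tagged t then e else swap e
  end.

Lemma edge_adj (e : edge G) : adj (val e).1 (val e).2.
Proof. by case: e => d /= /andP[]. Qed.

Lemma edge_neq (e : edge G) : ((val e).2 == (val e).1) = false.
Proof. by apply: contraTF (edge_adj e) => /eqP->; rewrite adj_irrefl. Qed.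

Lemma edge_swap (e e' : edge G) : val e <> swap (val e').
Proof.
case: e e' => [[x y] /= /andP[_ lt]] [[u v] /= /andP[_ lt']] [ex ey].
by move: lt; rewrite ex ey ltnNge ltnW.
Qed.

Lemma dart_edge (d : G * G) : d \in dart G ->
  exists e : edge G, d = val e \/ d = swap (val e).
Proof.
case: d => x y; rewrite inE /= => xy.
have [lt|gt|/val_inj/enum_rank_inj xy'] := ltngtP (enum_rank x) (enum_rank y).
- have P : adj x y && (enum_rank x < enum_rank y) by rewrite xy.
  by exists (Sub (x, y) P); left.
- have P : adj y x && (enum_rank y < enum_rank x) by rewrite adj_sym xy.
  by exists (Sub (y, x) P); right.
by rewrite xy' adj_irrefl in xy.
Qed.

Lemma sub_pt0 e : sub_pt e 0 = inl (val e).1.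
Proof. by []. Qed.

Lemma sub_pt_in e j (lt : j < k e) :
  sub_pt e j.+1 = inr (Tagged (fun e => 'I_(k e)) (Ordinal lt)).
Proof. by rewrite /sub_pt insubT. Qed.

Lemma sub_pt_last e : sub_pt e (k e).+1 = inl (val e).2.
Proof. by rewrite /sub_pt insubF // ltnn. Qed.

Lemma sub_pt_pos e j : j <= (k e).+1 -> sub_pos e (sub_pt e j) = j.
Proof.
case: j => [|j]; first by rewrite sub_pt0 /= eqxx.
rewrite ltnS leq_eqVlt => /orP[/eqP->|lt]; first by rewrite sub_pt_last /= edge_neq.
by rewrite (sub_pt_in lt).
Qed.

Lemma sub_ptS (s : subdividing k) :
  (inr s : H) = sub_pt (tag s) (nat_of_ord (tagged s)).+1.
Proof.
by case: s => e i; rewrite sub_pt_in; congr (inr (Tagged _ _)); apply: val_inj.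
Qed.

Lemma sub_dart_fwd e j : j <= k e ->
  sub_dart (sub_pt e j, sub_pt e j.+1) = val e.
Proof.
rewrite leq_eqVlt => /orP[/eqP->|lt].
  rewrite sub_pt_last; case E: (k e) => [|m].
    by rewrite sub_pt0 /= -surjective_pairing.
  have lt : m < k e by rewrite E.
  by rewrite (sub_pt_in lt) /= eqxx.
rewrite (sub_pt_in lt); case: j lt => [|j] lt; first by rewrite sub_pt0 /= eqxx.
by rewrite (sub_pt_in (ltnW lt)) /= ltnSn.
Qed.

Lemma sub_dart_bwd e j : j <= k e ->
  sub_dart (sub_pt e j.+1, sub_pt e j) = swap (val e).
Proof.
rewrite leq_eqVlt => /orP[/eqP->|lt].
  rewrite sub_pt_last; case E: (k e) => [|m]; first by rewrite sub_pt0.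
  have lt : m < k e by rewrite E.
  by rewrite (sub_pt_in lt) /= edge_neq.
rewrite (sub_pt_in lt); case: j lt => [|j] lt; first by rewrite sub_pt0 /= eq_sym edge_neq.
by rewrite (sub_pt_in (ltnW lt)) /= ltnNge leqnSn.
Qed.

Lemma sub_linkP a b :
  reflect (exists e j, [/\ j <= k e, a = sub_pt e j & b = sub_pt e j.+1])
          (subdiv_link a b).
Proof.
apply: (iffP idP) => [|[e [j [le -> ->]]]].
  case: a b => [x|s] [y|t] /=.
  - case/existsP=> e /andP[/eqP ev /eqP k0]; exists e, 0; split=> //.
      by rewrite sub_pt0 -[x]/(x, y).1 -ev.
    by rewrite -[1]/(0.+1) -[in RHS]k0 sub_pt_last -[y]/(x, y).2 -ev.
  - case/andP=> /eqP-> /eqP t0; exists (tag t), 0; split=> //.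
    by rewrite sub_ptS t0.
  - case/andP=> /eqP-> /eqP sk; exists (tag s), (tagged s).+1.
    by split; [exact: ltn_ord|exact: sub_ptS|rewrite sk sub_pt_last].
  - case/andP=> /eqP st /eqP sE; exists (tag s), (tagged s).+1.
    by split; [exact: ltn_ord|exact: sub_ptS|rewrite sE st sub_ptS].
move: le; rewrite leq_eqVlt => /orP[/eqP jk|lt].
  rewrite jk sub_pt_last; case E: (k e) => [|m].
    by apply/existsP; exists e; rewrite E -surjective_pairing !eqxx.
  have lt : m < k e by rewrite E.
  by rewrite (sub_pt_in lt) /= !eqxx E eqxx.
rewrite (sub_pt_in lt); case: j lt => [|j] lt; first by rewrite sub_pt0 /= eqxx.
by rewrite (sub_pt_in (ltnW lt)) /= !eqxx.
Qed.

Lemma sub_adjP (a b : H) :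
  reflect (exists e j, j <= k e /\ ((a, b) = (sub_pt e j, sub_pt e j.+1) \/
                                    (a, b) = (sub_pt e j.+1, sub_pt e j)))
          (adj a b).
Proof.
apply: (iffP orP) => [[] /sub_linkP[e [j [le -> ->]]]|[e [j [le [][-> ->]]]]].
- by exists e, j; split=> //; left.
- by exists e, j; split=> //; right.
- by left; apply/sub_linkP; exists e, j.
- by right; apply/sub_linkP; exists e, j.
Qed.

Lemma sub_adj_pt e j : j <= k e -> @adj H (sub_pt e j) (sub_pt e j.+1).
Proof. by move=> le; apply/sub_adjP; exists e, j; split=> //; left. Qed.

(** The neighbour of [inl x] towards [y]. The default [inl x] is never adjacent to [inl x], so that
    [first_dart] of a non-dart is not a dart. *)
Definition sub_next (x y : G) : H :=
  if insub (x, y) is Some e then sub_pt e 1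
  else if insub (y, x) is Some e then sub_pt e (k e) else inl x.

Definition first_dart (d : G * G) : H * H := (inl d.1, sub_next d.1 d.2).

Lemma first_dart_fwd (e : edge G) : first_dart (val e) = (sub_pt e 0, sub_pt e 1).
Proof. by rewrite /first_dart /sub_next -surjective_pairing valK. Qed.

Lemma first_dart_bwd (e : edge G) :
  first_dart (swap (val e)) = (sub_pt e (k e).+1, sub_pt e (k e)).
Proof.
rewrite /first_dart /sub_next /= insubF; last first.
  by case: e => -[x y] /= /andP[xy lt]; rewrite ltnNge ltnW ?andbF.
by rewrite -surjective_pairing valK sub_pt_last.
Qed.

Lemma first_dartK d : d \in dart G -> sub_dart (first_dart d) = d.
Proof.
move=> /dart_edge[e [->|->]]; rewrite ?first_dart_fwd ?first_dart_bwd.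
  exact: sub_dart_fwd.
exact: sub_dart_bwd.
Qed.

Lemma first_dart_dart d : (first_dart d \in dart H) = (d \in dart G).
Proof.
apply/idP/idP=> [|/dart_edge[e [->|->]]]; last 2 first.
- by rewrite first_dart_fwd inE sub_adj_pt.
- by rewrite first_dart_bwd inE adj_sym sub_adj_pt.
case: d => x y; rewrite /first_dart /sub_next /=.
case: insubP => [e _ ev _|_]; first by rewrite inE -[x]/(x, y).1 -[y]/(x, y).2 -ev edge_adj.
case: insubP => [e _ ev _|_]; last by rewrite inE adj_irrefl.
by rewrite inE adj_sym /= -[y]/(y, x).1 -[X in adj _ X]/(y, x).2 -ev edge_adj.
Qed.

Lemma sub_dart_dart d : d \in dart H -> sub_dart d \in dart G.
Proof.
case: d => a b /sub_adjP[e [j [le [->|->]]]].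
  by rewrite sub_dart_fwd // inE edge_adj.
by rewrite sub_dart_bwd // inE adj_sym edge_adj.
Qed.

Lemma dart_at_vertex x b : (inl x, b) \in dart H ->
  exists2 y, adj x y & (inl x, b) = first_dart (x, y).
Proof.
case/sub_adjP=> e [j [le [E|E]]].
  case: j le E => [|j] le; last by rewrite [sub_pt e j.+1]sub_pt_in.
  case=> -> ->; exists (val e).2; first exact: edge_adj.
  by rewrite -surjective_pairing first_dart_fwd.
move: le E; rewrite leq_eqVlt => /orP[/eqP->|lt]; last by rewrite [sub_pt e j.+1]sub_pt_in.
rewrite sub_pt_last => -[-> ->]; exists (val e).1; first by rewrite adj_sym edge_adj.
by rewrite -/(swap (val e)) first_dart_bwd sub_pt_last.
Qed.

Lemma sub_pt_eq_in e j e' j' : j < k e -> sub_pt e' j' = sub_pt e j.+1 ->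
  e' = e /\ j' = j.+1.
Proof.
move=> lt /(congr1 (fun a : H =>
  if a is inr s then Some (tag s, nat_of_ord (tagged s)) else None)).
rewrite sub_pt_in; case: j' => [|i]; first by rewrite sub_pt0.
by rewrite /sub_pt; case: insubP => //= o _ <- [ee oj]; rewrite oj.
Qed.

Lemma sub_pt_nbrs e j : j < k e ->
  [set z | @adj H (sub_pt e j.+1) z] = [set sub_pt e j; sub_pt e j.+2].
Proof.
move=> lt; apply/setP=> z; rewrite !inE; apply/idP/orP=> [|[/eqP->|/eqP->]]; last 2 first.
- by rewrite adj_sym sub_adj_pt // ltnW.
- exact: sub_adj_pt.
case/sub_adjP=> e' [j' [_ [[/esym E ->]|[/esym E ->]]]].
  by have [-> ->] := sub_pt_eq_in lt E; right.
by have [-> [->]] := sub_pt_eq_in lt E; left.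
Qed.

Lemma sub_pt_neq2 e j : j < k e -> sub_pt e j != sub_pt e j.+2.
Proof.
move=> lt; have le : j <= (k e).+1 := leq_trans (ltnW lt) (leqnSn _).
apply/eqP=> /(congr1 (sub_pos e)); rewrite (sub_pt_pos le) (@sub_pt_pos e j.+2 lt).
by move/eqP; rewrite -addn2 -{1}[j]addn0 eqn_add2l.
Qed.

Section Lift.
Variables (P : G -> {perm G}) (rho : H -> {perm H}).
Hypotheses (rP : rotation_system P) (rr : rotation_system rho).
Hypothesis lift : forall x y, adj x y -> rho (inl x) (sub_next x y) = sub_next x (P x y).

(** A cyclic order on two neighbours can only exchange them, so faces pass straight through a
    subdividing vertex. *)
Lemma rotation_sub_pt e j : j < k e ->
  rho (sub_pt e j.+1) (sub_pt e j) = sub_pt e j.+2 /\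
  rho (sub_pt e j.+1) (sub_pt e j.+2) = sub_pt e j.
Proof.
move=> lt; set u := sub_pt e j.+1; set a := sub_pt e j; set b := sub_pt e j.+2.
have ab : a != b := sub_pt_neq2 lt.
have ua : @adj H u a by have /setP/(_ a) := sub_pt_nbrs lt; rewrite !inE eqxx.
have o : porbit (rho u) a = [set a; b] by rewrite rr // sub_pt_nbrs.
have cyc c : c \in [set a; b] -> rho u c \in [set a; b].
  by rewrite -o mem_porbit_step.
have ra : rho u a = b.
  have := cyc a; rewrite !inE eqxx => /(_ isT)/orP[/eqP ra|/eqP //].
  have /setP/(_ b) := porbit_fix ra; rewrite o !inE eqxx orbT.
  by rewrite eq_sym (negPf ab).
split=> //; have := cyc b; rewrite !inE eqxx orbT => /(_ isT)/orP[/eqP //|/eqP rb].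
by move: ab; rewrite -(inj_eq (@perm_inj _ (rho u))) ra rb eqxx.
Qed.

Lemma face_step_fwd e j : j < k e ->
  face_step rho (sub_pt e j, sub_pt e j.+1) = (sub_pt e j.+1, sub_pt e j.+2).
Proof. by move=> lt; rewrite /face_step /= (rotation_sub_pt lt).1. Qed.

Lemma face_step_bwd e j : j < k e ->
  face_step rho (sub_pt e j.+2, sub_pt e j.+1) = (sub_pt e j.+1, sub_pt e j).
Proof. by move=> lt; rewrite /face_step /= (rotation_sub_pt lt).2. Qed.

Lemma fconnect_first_fwd e j : j <= k e ->
  fconnect (face_step rho) (first_dart (val e)) (sub_pt e j, sub_pt e j.+1).
Proof.
rewrite first_dart_fwd; elim: j => [|j IH] lt; first exact: connect0.
by apply: connect_trans (IH (ltnW lt)) _; rewrite -face_step_fwd // fconnect1.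
Qed.

Lemma fconnect_first_bwd e j : j <= k e ->
  fconnect (face_step rho) (first_dart (swap (val e))) (sub_pt e j.+1, sub_pt e j).
Proof.
move=> le; rewrite first_dart_bwd; rewrite -(subKn le).
elim: (k e - j) (leq_subr j (k e)) => [|m IH] lt; first by rewrite subn0 connect0.
apply: connect_trans (IH (ltnW lt)) _.
have -> : k e - m = (k e - m.+1).+1 by rewrite subnSK.
have lt' : k e - m.+1 < k e by rewrite ltn_subrL /=; exact: leq_ltn_trans lt.
by rewrite -(face_step_bwd lt') fconnect1.
Qed.

Lemma fconnect_first_dart d : d \in dart H ->
  fconnect (face_step rho) (first_dart (sub_dart d)) d.
Proof.
case: d => a b /sub_adjP[e [j [le [->|->]]]].
  by rewrite sub_dart_fwd // fconnect_first_fwd.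
by rewrite sub_dart_bwd // fconnect_first_bwd.
Qed.

Lemma face_step_last (e : edge G) (d := val e) :
  face_step rho (sub_pt e (k e), sub_pt e (k e).+1) = first_dart (face_step P d) /\
  face_step rho (sub_pt e 1, sub_pt e 0) = first_dart (face_step P (swap d)).
Proof.
have xy := edge_adj e; have := first_dart_fwd e; have := first_dart_bwd e.
rewrite /first_dart sub_pt_last /= => -[eb] [ef].
split; rewrite /face_step ?sub_pt_last /=.
  by rewrite -eb lift // adj_sym.
by rewrite -ef lift.
Qed.

Lemma fconnect_first_step d : d \in dart G ->
  fconnect (face_step rho) (first_dart d) (first_dart (face_step P d)).
Proof.
case/dart_edge=> e [->|->].
  rewrite -(face_step_last e).1.
  exact: connect_trans (fconnect_first_fwd (leqnn _)) (fconnect1 _ _).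
rewrite -(face_step_last e).2.
exact: connect_trans (fconnect_first_bwd (leq0n _)) (fconnect1 _ _).
Qed.

Lemma sub_dart_step d : d \in dart H ->
  sub_dart (face_step rho d) = sub_dart d \/
  sub_dart (face_step rho d) = face_step P (sub_dart d).
Proof.
case: d => a b /sub_adjP[e [j [le [->|->]]]].
  rewrite [sub_dart (sub_pt e j, _)]sub_dart_fwd //.
  move: le; rewrite leq_eqVlt => /orP[/eqP->|lt].
    right; rewrite (face_step_last e).1 first_dartK // face_step_dart //.
    by rewrite inE edge_adj.
  by left; rewrite face_step_fwd // sub_dart_fwd.
rewrite [sub_dart (sub_pt e j.+1, _)]sub_dart_bwd //.
case: j le => [|j] lt.
  right; rewrite (face_step_last e).2 first_dartK // face_step_dart //.
  by rewrite inE adj_sym edge_adj.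
by left; rewrite face_step_bwd // sub_dart_bwd // ltnW.
Qed.

(** One step of [P] expands to a trace of [rho] along a whole path. Conversely, along a trace of
    [rho] the value of [sub_dart] either stays or makes one step of [P]. *)
Lemma fconnect_lift d d' : d \in dart G ->
  fconnect (face_step rho) (first_dart d) (first_dart d') = fconnect (face_step P) d d'.
Proof.
move=> dG; apply/idP/idP=> /iter_findex; move: (findex _ _ _) => i; last first.
  elim: i d' => [|i IH] d' => [<-|]; first exact: connect0.
  rewrite iterS => <-; set d1 := iter _ _ _.
  have d1G : d1 \in dart G.
    by rewrite /d1; elim: (i) => //= m Hm; rewrite face_step_dart.
  exact: connect_trans (IH d1 erefl) (fconnect_first_step d1G).
move=> E.
have [iH cH] : iter i (face_step rho) (first_dart d) \in dart H /\
    fconnect (face_step P) d (sub_dart (iter i (face_step rho) (first_dart d))).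
  elim: i {E} => [|i [IH1 IH2]]; first by rewrite first_dart_dart first_dartK // connect0.
  rewrite iterS face_step_dart //; split=> //.
  have [->|->] := sub_dart_step IH1 => //.
  exact: connect_trans IH2 (fconnect1 _ _).
by move: iH cH; rewrite E first_dart_dart => d'G; rewrite first_dartK.
Qed.

Lemma fcard_lift : fcard (face_step rho) (dart H) = fcard (face_step P) (dart G).
Proof.
have cl : fclosed (face_step rho) (dart H).
  by move=> d _ /eqP<-; rewrite face_step_dart.
rewrite (adjunction_n_comp first_dart (@face_step_sym _ _) (@face_step_sym _ P) cl).
  by apply: eq_n_comp_r => d; rewrite inE first_dart_dart.
split=> [d dH|d d']; first by exists (sub_dart d); rewrite face_step_sym fconnect_first_dart.
by rewrite first_dart_dart => dG; rewrite fconnect_lift.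
Qed.

(** Incidence is defined on [G], while edges are inserted at corners of the subdivision. A
    subdividing vertex has two outgoing darts, one for each direction of its edge; they match the
    two cases of [edge_on_face]. *)
Lemma on_faceP d a : d \in dart G ->
  on_face P d a <->
  exists2 b, adj a b & fconnect (face_step rho) (first_dart d) (a, b).
Proof.
move=> dG; case: a => [x|s] /=; split.
- case=> y; rewrite -fconnect_lift // => c; exists (sub_next x y) => //.
  suff : first_dart (x, y) \in dart H by [].
  have clH : fclosed (face_step rho) (dart H).
    by move=> d' _ /eqP<-; rewrite face_step_dart.
  by rewrite -(closed_connect clH c) first_dart_dart.
- case=> b xb; have [y xy ->] := dart_at_vertex xb; rewrite fconnect_lift //.
  by exists y.
- rewrite /edge_on_face -/(swap (val (tag s))) -!fconnect_lift // => -[] c.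
    exists (sub_pt (tag s) (tagged s).+2).
      by rewrite [inr s]sub_ptS; apply: sub_adj_pt; exact: ltn_ord.
    by apply: connect_trans c _; rewrite [inr s]sub_ptS; apply/fconnect_first_fwd/ltn_ord.
  have sb : @adj H (inr s) (sub_pt (tag s) (tagged s)).
    by rewrite (@adj_sym H) [inr s]sub_ptS; apply/sub_adj_pt/ltnW/ltn_ord.
  exists (sub_pt (tag s) (tagged s)) => //.
  by apply: connect_trans c _; rewrite [inr s]sub_ptS; apply/fconnect_first_bwd/ltnW/ltn_ord.
case=> b sb c; have c' : fconnect (face_step P) d (sub_dart (inr s, b)).
  rewrite -fconnect_lift //; have c2 := @fconnect_first_dart (inr s, b) sb.
  by rewrite (@face_step_sym H rho) in c2; apply: connect_trans c c2.
case: b sb c c' => [y|t] sb _ /=; case: ifP => _; by [left|right].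
Qed.

End Lift.

Lemma sub_next_nbr x y : adj x y -> @adj H (inl x) (sub_next x y).
Proof. by move=> xy; have := first_dart_dart (x, y); rewrite ![_ \in _]inE /= xy. Qed.

Lemma sub_next_back x y : adj x y -> (sub_dart (inl x, sub_next x y)).2 = y.
Proof. by move=> xy; rewrite -[(inl x, _)]/(first_dart (x, y)) first_dartK. Qed.

Lemma sub_back_next x b : @adj H (inl x) b ->
  adj x (sub_dart (inl x, b)).2 /\ sub_next x (sub_dart (inl x, b)).2 = b.
Proof.
move=> xb; have [y xy E] := @dart_at_vertex x b xb.
by rewrite {1 2}E first_dartK //=; split=> //; case: E.
Qed.

(** At an original vertex the rotation is carried along [sub_next x]; at a subdividing vertex the
    exchange of its two neighbours is the only choice. *)
Lemma rotation_lift (P : G -> {perm G}) : rotation_system P ->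
  exists2 rho : H -> {perm H}, rotation (@adj H) rho &
    forall x y, adj x y -> rho (inl x) (sub_next x y) = sub_next x (P x y).
Proof.
move=> rP.
have hx (x : G) : exists s : {perm H}, rotates s [set z | @adj H (inl x) z]
    /\ (forall y, adj x y -> s (sub_next x y) = sub_next x (P x y)).
  have [] := @transport_cyclic _ _ (sub_next x) (fun b => (sub_dart (inl x, b)).2)
    [set z | adj x z] [set z | @adj H (inl x) z] (P x).
  - by move=> y; rewrite !inE; apply: sub_next_nbr.
  - by move=> b; rewrite !inE => /sub_back_next[].
  - by move=> y; rewrite inE => /sub_next_back.
  - by move=> b; rewrite inE => /sub_back_next[].
  - by move=> y; rewrite inE; apply: rP.
  move=> s [e f c]; exists s; split=> [|y xy]; first by split=> // y; apply: f.
  by apply: e; rewrite inE.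
have /fin_all_exists[rho r0] (x : H) : exists s : {perm H},
    rotates s [set z | @adj H x z] /\
    (if x is inl x' then forall y, adj x' y -> s (sub_next x' y) = sub_next x' (P x' y)
     else True).
  case: x => [x|t]; first exact: hx.
  have lt : tagged t < k (tag t) := ltn_ord _.
  rewrite [inr t]sub_ptS sub_pt_nbrs //.
  set a := sub_pt _ _; set b := sub_pt _ _; have ab : a != b := sub_pt_neq2 lt.
  exists (tperm a b); split; last by [].
  split=> [c cab|c]; last by rewrite !inE negb_or => /andP[ca cb]; rewrite tpermD // eq_sym.
  have [] := @tperm_mul_join _ 1%g a b; first by rewrite porbit_fix ?perm1 // inE.
  rewrite mulg1 !(porbit_fix (perm1 _)) => ea eb.
  by move: cab; rewrite !inE => /orP[]/eqP->.
by exists rho => [x|x y]; [have [] := r0 x|have [_] := r0 (inl x); apply].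
Qed.

Lemma rotation_unlift (rho : H -> {perm H}) : rotation_system rho ->
  exists2 P : G -> {perm G}, rotation (@adj G) P &
    forall x y, adj x y -> rho (inl x) (sub_next x y) = sub_next x (P x y).
Proof.
move=> rr.
have /fin_all_exists[P r0] (x : G) : exists s : {perm G},
    rotates s [set z | adj x z] /\
    (forall y, adj x y -> rho (inl x) (sub_next x y) = sub_next x (s y)).
  have [] := @transport_cyclic _ _ (fun b => (sub_dart (inl x, b)).2) (sub_next x)
    [set z | @adj H (inl x) z] [set z | adj x z] (rho (inl x)).
  - by move=> b; rewrite !inE => /sub_back_next[].
  - by move=> y; rewrite !inE; apply: sub_next_nbr.
  - by move=> b; rewrite inE => /sub_back_next[].
  - by move=> y; rewrite inE => /sub_next_back.
  - by move=> y; rewrite inE; apply: rr.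
  move=> s [e f c]; exists s; split=> [|y xy]; first by split=> // y; apply: f.
  have xn := sub_next_nbr xy; have := e (sub_next x y); rewrite inE xn => /(_ isT).
  rewrite sub_next_back // => ->.
  have xr : @adj H (inl x) (rho (inl x) (sub_next x y)).
    have /setP/(_ (rho (inl x) (sub_next x y))) := rr _ _ xn.
    by rewrite mem_porbit_step porbit_id inE.
  by have [_ ->] := sub_back_next xr.
by exists P => [x|x y]; have [] := r0 x => // _; apply.
Qed.

Lemma connected_subdivision : connected G -> connected H.
Proof.
move=> cG.
have cs : connect_sym (@adj H) by apply: sym_connect_sym; exact: adj_sym.
have cpt e j : j <= (k e).+1 -> connect (@adj H) (inl (val e).1) (sub_pt e j).
  elim: j => [|j IH] le; first exact: connect0.
  exact: connect_trans (IH (ltnW le)) (connect1 (sub_adj_pt le)).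
have cV x y : connect (@adj H) (inl x) (inl y).
  have /connectP[p xp ->] := cG x y; elim: p x xp => [|z p IH] x //= /andP[xz zp].
  apply: connect_trans (IH z zp).
  have [e [E|E]] := @dart_edge (x, z) xz.
    by have := cpt e _ (leqnn _); rewrite sub_pt_last -E.
  by have := cpt e _ (leqnn _); rewrite sub_pt_last cs; case: E => -> ->.
have toV (a : H) : exists x, connect (@adj H) (inl x) a.
  case: a => [x|s]; first by exists x.
  by exists (val (tag s)).1; rewrite [inr s]sub_ptS; apply/cpt/ltnW/ltn_ord.
move=> a b; have [x xa] := toV a; have [y yb] := toV b.
by apply: connect_trans yb; rewrite cs in xa; apply: connect_trans xa (cV x y).
Qed.

(** An edge with [k e] subdividing vertices becomes [k e + 1] edges, so edges and vertices grow
    alike. The count is made on darts, each given by a position on a path and a direction. *)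
Lemma card_subdivision : #|edge H| + #|G| = #|edge G| + #|H|.
Proof.
pose I : finType := ({e : edge G & 'I_(k e).+1} * bool)%type.
pose f (i : I) : H * H :=
  let d := (sub_pt (tag i.1) (tagged i.1), sub_pt (tag i.1) (tagged i.1).+1) in
  if i.2 then d else swap d.
have f_inj : injective f.
  move=> [[e j] b] [[e' j'] b']; rewrite /f /= => E.
  have lj : j <= k e := ltn_ord j.
  have lj' : j' <= k e' := ltn_ord j'.
  have D (e1 : edge G) (j1 : nat) (b1 : bool) : j1 <= k e1 ->
      sub_dart (if b1 then (sub_pt e1 j1, sub_pt e1 j1.+1)
        else swap (sub_pt e1 j1, sub_pt e1 j1.+1)) = if b1 then val e1 else swap (val e1).
    by case: b1 => le; rewrite (sub_dart_fwd, sub_dart_bwd).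
  have := congr1 sub_dart E; rewrite !D // => E2.
  have [ee bb] : e = e' /\ b = b'.
    move: E2; case: (b) (b') => -[] E2; split=> //; try by apply: val_inj.
    - by case: (edge_swap E2).
    - by case: (edge_swap E2).
    - by case: (edge_swap (esym E2)).
    - by case: (edge_swap (esym E2)).
    - by apply: val_inj; move: E2; rewrite /swap; case: (val e) (val e') => ? ? [? ?] [-> ->].
  subst e' b'; congr (Tagged _ _, _); apply: val_inj.
  have pos := @sub_pt_pos e; have := congr1 (fun d => if b then d.1 else d.2) E.
  case: (b) => /= /(congr1 (sub_pos e)); by rewrite !pos //; apply: leq_trans (leqnSn _).
have : #|dart H| = #|I|.
  rewrite -(card_codom f_inj); apply: eq_card => -[a b].
  apply/idP/codomP=> [/sub_adjP[e [j [le [->|->]]]]|[[[e j] b'] ->]].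
  - by exists (Tagged (fun e => 'I_(k e).+1) (Ordinal (le : j < (k e).+1)), true).
  - by exists (Tagged (fun e => 'I_(k e).+1) (Ordinal (le : j < (k e).+1)), false).
  have lj : j <= k e := ltn_ord j.
  have := sub_adj_pt lj; by case: b' => //; rewrite adj_sym.
rewrite card_dart_edge card_prod card_bool muln2 => /double_inj ->.
have -> : #|{: {e : edge G & 'I_(k e).+1}}| = #|edge G| + #|subdividing k|.
  rewrite !card_tagged !sumnE !big_map [#|edge G|]cardT enumT -sum1_size -big_split /=.
  by apply: eq_bigr => e _; rewrite !card_ord.
by rewrite card_sum -addnA [#|subdividing k| + _]addnC.
Qed.

End Subdivision.

(** * The wheel *)

(** Once [s a] is known the rest is forced: returning to [a] after two steps would leave out the
    third element. *)
Lemma cyclic3 (T : finType) (s : {perm T}) (a b c : T) :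
  [/\ a != b, a != c & b != c] -> porbit s a = [set a; b; c] ->
  [/\ s a = b, s b = c & s c = a] \/ [/\ s a = c, s c = b & s b = a].
Proof.
have half x y z : x != y -> x != z -> y != z -> porbit s x = [set x; y; z] ->
    s x = y -> s y = z /\ s z = x.
  move=> xy xz yz o sx.
  have syN : s y != y by apply: contraNneq xy => e; apply/eqP/(@perm_inj _ s); rewrite sx e.
  have mem u : u \in [set x; y; z] -> s u \in [set x; y; z].
    by rewrite -o mem_porbit_step.
  have := mem y; rewrite !inE eqxx orbT => /(_ isT).
  rewrite (negPf syN) orbF => /orP[/eqP sy|/eqP sy].
    have : porbit s x \subset [set x; y].
      apply: porbit_closed => [u|]; rewrite !inE ?eqxx //.
      by case/orP=> /eqP->; rewrite ?sx ?sy eqxx ?orbT.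
    rewrite o => /subsetP/(_ z); rewrite !inE eqxx orbT => /(_ isT).
    by rewrite ![z == _]eq_sym (negPf xz) (negPf yz).
  split=> //; have := mem z; rewrite !inE eqxx orbT => /(_ isT).
  have -> : (s z == y) = false by rewrite -sx (inj_eq perm_inj) eq_sym (negPf xz).
  have -> : (s z == z) = false by rewrite -{2}sy (inj_eq perm_inj) eq_sym (negPf yz).
  by rewrite !orbF => /eqP.
move=> [ab ac bc] o.
have := porbit_id s (s a); rewrite porbit_step o !inE => /orP[/orP[]|] /eqP sa.
- by have /setP/(_ b) := porbit_fix sa; rewrite o !inE eqxx orbT [b == a]eq_sym (negPf ab).
- by left; have [] := half a b c ab ac bc o sa.
- right; have [] := half a c b ac ab _ _ sa; rewrite 1?eq_sym //.
  by rewrite o; apply/setP=> u; rewrite !inE orbAC.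
Qed.

Section Wheel.
Variable n : nat.
Hypothesis hn : 3 <= n.
Local Notation W := (wheel n).

Definition turn (b : bool) (i : 'I_n) : 'I_n := if b then ordS i else ord_pred i.

Lemma turnK b : cancel (turn b) (turn (~~ b)).
Proof. by case: b => i; rewrite /turn /= ?ordSK ?ord_predK. Qed.

Lemma iter_ordS m (i : 'I_n) : val (iter m (@ordS n) i) = (i + m) %% n.
Proof.
elim: m => [|m IH]; first by rewrite addn0 modn_small.
by rewrite iterS /= IH -addn1 modnDml addn1 addnS.
Qed.

Lemma turn_reach b i j : exists m, j = iter m (turn b) i.
Proof.
have S (i' j' : 'I_n) : exists m, j' = iter m (@ordS n) i'.
  (* [n - i'] steps complete the turn to 0, and [j'] more reach the target, whichever index is
     larger. *)
  exists (j' + (n - i')); apply: val_inj; rewrite iter_ordS addnCA subnKC ?modnDr.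
    by rewrite modn_small.
  exact: ltnW.
case: b; first exact: S.
have [m ->] := S j i; exists m.
by elim: m => // m IH; rewrite iterSr [iter m.+1 (@ordS n) j]iterS [turn _ _]ordSK.
Qed.

Lemma turn_neq b i : turn b i != i.
Proof.
have S (j : 'I_n) : ordS j != j.
  apply/eqP=> /(congr1 val) /=; have := ltn_ord j.
  rewrite leq_eqVlt => /orP[/eqP e|lt]; last by rewrite modn_small //; lia.
  rewrite e modnn; lia.
case: b => /=; first exact: S.
by apply: contraNneq (S (ord_pred i)) => e; rewrite ord_predK e.
Qed.

(** This is where [3 <= n] matters: on two rim vertices both directions lead to the same one. *)
Lemma turn_neqN b i : turn b i != turn (~~ b) i.
Proof.
have S (j : 'I_n) : ordS j != ord_pred j.
  apply/eqP=> /(congr1 (@ordS n)); rewrite ord_predK => /(congr1 val) /=.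
  rewrite -[(j.+1 %% n).+1]addn1 modnDml addn1 -addn2 => e.
  have lt := ltn_ord j; have [lt2|ge] := ltnP (j + 2) n.
    by rewrite modn_small // in e; move: e; clear; lia.
  have : (j + 2 - n + n) %% n = j by rewrite subnK // -e; congr (_ %% _); lia.
  rewrite modnDr modn_small; lia.
by case: b => /=; rewrite ?(eq_sym (ord_pred i)) S.
Qed.

Lemma wheel_nbrs (i : 'I_n) b :
  [set z | @adj W (Some i) z] = [set None; Some (turn b i); Some (turn (~~ b) i)].
Proof.
have SP (j : 'I_n) : (i == ordS j) = (j == ord_pred i).
  by rewrite -[i in LHS]ord_predK (inj_eq (can_inj (@ordSK n))) eq_sym.
apply/setP=> -[j|]; rewrite !inE //= SP.
have -> : (j == ordS i) || (j == ord_pred i) = (j == turn b i) || (j == turn (~~ b) i).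
  by case: b => //=; rewrite orbC.
rewrite andb_idl // => /orP[]/eqP->; by rewrite eq_sym turn_neq.
Qed.

Lemma card_wheel_edge : #|edge W| = n.*2.
Proof.
apply: double_inj; rewrite -card_dart_edge.
have -> : #|dart W| = \sum_(x : W) #|[set y | @adj W x y]|.
  rewrite -sum1_card (eq_bigr (fun x => \sum_(y | @adj W x y) 1)) => [|x _].
    by rewrite pair_big_dep; apply: eq_bigl => -[x y]; rewrite inE.
  by rewrite -sum1_card; apply: eq_bigl => y; rewrite inE.
rewrite (bigD1 None) //= (eq_bigr (fun _ => 3)) => [|[i|] //= _]; last first.
  have /setP wn := wheel_nbrs i true; rewrite (eq_card wn).
  rewrite -setUA cardsU1 cards2 !inE /=.
  by rewrite (inj_eq (@Some_inj _)) (turn_neqN true).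
rewrite sum_nat_const.
have -> : #|[set y | @adj W None y]| = n.
  have inj : injective (@Some 'I_n) by move=> i j [].
  rewrite -[RHS]card_ord -(card_imset _ inj); apply: eq_card => -[i|].
    by rewrite inE /= imset_f.
  by rewrite inE /=; apply/esym/imsetP => -[].
rewrite (_ : #|_| = n); first by rewrite -!addnn; lia.
by rewrite -[RHS]card_ord -[#|'I_n|]/(#|'I_n|.+1.-1) -card_option -(cardC1 None); apply: eq_card.
Qed.

(** [b] is the local orientation at [i]; a rim vertex has degree three, hence only two possible
    rotations. *)
Definition wheel_sign (P : W -> {perm W}) b i :=
  [/\ P (Some i) None = Some (turn b i),
      P (Some i) (Some (turn b i)) = Some (turn (~~ b) i) &
      P (Some i) (Some (turn (~~ b) i)) = None].

Lemma wheel_sign_ex (P : W -> {perm W}) i : rotation_system P ->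
  exists b, wheel_sign P b i.
Proof.
move=> rP; have := @cyclic3 _ (P (Some i)) None (Some (turn true i)) (Some (turn false i)).
case.
- by split=> //; rewrite (inj_eq (@Some_inj _)) (turn_neqN true).
- by rewrite (rP (Some i) None) // (wheel_nbrs i true).
- by move=> h; exists true.
- by move=> [? ? ?]; exists false; split.
Qed.

Lemma wheel_rigid (P : W -> {perm W}) : rotation_system P ->
  n < fcard (face_step P) (dart W) ->
  fcard (face_step P) (dart W) = n.+1 /\
  exists b, [/\ forall i, wheel_sign P b i,
    forall i, P None (Some (turn b i)) = Some i &
    forall i j : 'I_n, fconnect (face_step P) (None, Some i) (None, Some j) -> i = j].
Proof.
move=> rP; set f := face_step P => lt.
have /fin_all_exists[sg sgP] i := wheel_sign_ex i rP.
have fs : connect_sym (frel f) by exact: face_step_sym.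
pose rim c i : W * W := (Some i, Some (turn c i)).
have neqN (a b : bool) : a != b -> a = ~~ b by case: a b => -[].
(* A face running along the rim in direction [c] turns into the spoke exactly where the sign is [c],
   and keeps to the rim elsewhere. *)
have stepE c i : f (rim c i) =
    if sg (turn c i) == c then (Some (turn c i), None) else rim c (turn c i).
  rewrite -[LHS]/(Some (turn c i), P (Some (turn c i)) (Some i)) /rim.
  have [_ e1 e2] := sgP (turn c i); have ij := turnK c i.
  case: eqP => [e|/eqP ne]; first by rewrite e ij in e2; rewrite e2.
  have ee := neqN _ _ ne.
  by rewrite ee ij negbK in e1; rewrite e1.
have centre x : f (x, None) = (None, P None x) by [].
have toNone i : exists j, P None (Some i) = Some j.
  case E: (P None (Some i)) => [j|]; first by exists j.
  have := @face_step_dart W P (Some i, None) rP.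
  by rewrite /face_step /= E !inE.
pose meets d := [exists j, fconnect f d (None, Some j)].
(* A face leaving a rim edge without ever reaching the centre turns the whole rim. *)
have avoid c i : ~~ meets (rim c i) ->
    forall j, sg j = ~~ c /\ fconnect f (rim c i) (rim c j).
  move=> nm.
  have st m : fconnect f (rim c i) (rim c (iter m (turn c) i)) /\
      sg (iter m.+1 (turn c) i) = ~~ c.
    have next j : fconnect f (rim c i) (rim c j) -> sg (turn c j) = ~~ c.
      move=> cj; apply/eqP; apply: contraNT nm => ne.
      have e : sg (turn c j) == c by rewrite (neqN _ _ ne) negbK.
      have [u hu] := toNone (turn c j).
      apply/existsP; exists u; apply: connect_trans cj _.
      apply: connect_trans (fconnect1 _ _) _; rewrite stepE e -hu -centre.
      exact: fconnect1.
    elim: m => [|m [IH1 IH2]]; first by split; [exact: connect0|apply/next/connect0].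
    suff h : fconnect f (rim c i) (rim c (iter m.+1 (turn c) i)) by split=> //; exact: next h.
    apply: connect_trans IH1 _; apply: connect_trans (fconnect1 _ _) _.
    rewrite stepE -iterS IH2; case: (c) => /=; exact: connect0.
  move=> j; split; last by have [m ->] := turn_reach c i j; case: (st m).
  have [m E] := turn_reach c (turn c i) j.
  by have := (st m).2; rewrite iterSr -E.
pose i0 : 'I_n := Ordinal (ltn_trans (isT : 0 < 2) hn).
(* [Im] collects the faces through the centre. A face avoiding the centre runs against every sign,
   so its direction can be read off at [i0], and [r0] is its only possible root. *)
pose Im := [set froot f (None, Some i) | i : 'I_n].
pose r0 := froot f (rim (~~ sg i0) i0).
pose R := [set d | (d \in froots f) && (d \in dart W)].
have RE : fcard f (dart W) = #|R| by apply: eq_card => d; rewrite !inE.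
have Rsub d : d \in R -> (d \in Im) \/
    exists c i, [/\ d = rim c i, ~~ meets d & d = r0].
  rewrite inE => /andP[/eqP rd dW].
  have [/existsP[j dj]|nm] := boolP (meets d).
    by left; apply/imsetP; exists j => //; rewrite -[LHS]rd; apply/(rootP fs).
  right; case: d rd dW nm => -[i|] [j|] rd dW nm.
  - have jN : Some j \in [set z | @adj W (Some i) z] by rewrite inE.
    have [c ji] : exists c, j = turn c i.
      move: jN; rewrite (wheel_nbrs i true) !inE /= => /orP[]/eqP[->].
        by exists true.
      by exists false.
    rewrite ji in rd nm *; exists c, i; split=> //.
    have sc := avoid c i nm; rewrite -[LHS]rd /r0 (sc i0).1 negbK.
    by apply/(rootP fs); case: (sc i0).
  - case/negP: nm; apply/existsP; have [u hu] := toNone i; exists u.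
    by rewrite -hu -centre fconnect1.
  - by case/negP: nm; apply/existsP; exists j; exact: connect0.
  - by rewrite inE in dW.
have ImR : #|Im| <= n by rewrite (leq_trans (leq_imset_card _ _)) // card_ord.
have RIm : R \subset r0 |: Im.
  apply/subsetP=> d /Rsub[dI|[c [i [_ _ ->]]]]; first by rewrite inE dI orbT.
  exact: setU11.
have Imn : #|Im| = n.
  apply/eqP; rewrite eqn_leq ImR /=; have := subset_leq_card RIm.
  rewrite -RE cardsU1 => le; have := leq_trans lt le.
  by case: (_ \notin _); [|move/ltnW].
split.
  apply/eqP; rewrite eqn_leq lt andbT RE (leq_trans (subset_leq_card RIm)) //.
  by rewrite cardsU1 Imn; case: (_ \notin _).
have [x xR xI] : exists2 x, x \in R & x \notin Im.
  apply/subsetPn; apply: contraTN lt => /subset_leq_card; rewrite Imn -RE.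
  by rewrite -leqNgt.
have [xIm|[c [i [xE nm _]]]] := Rsub x xR; first by rewrite xIm in xI.
have sgE j : sg j = ~~ c by rewrite xE in nm; case: (avoid c i nm j).
have inj (u v : 'I_n) : fconnect f (None, Some u) (None, Some v) -> u = v.
  move=> uv; have /imset_injP inj : #|Im| == #|'I_n| by rewrite Imn card_ord.
  by apply: inj => //; apply/(rootP fs).
exists (~~ c); split=> [j|j|//]; first by rewrite -(sgE j).
(* Three steps from [(None, Some j)] go out along a spoke, over one rim edge, and in and out through
   the centre to [(None, Some u)]. Since distinct centre darts lie in distinct faces, the triangle
   closes there. *)
have [u hu] := toNone (turn (~~ c) j); rewrite hu; congr Some; apply/esym/inj.
rewrite -hu -centre.
have -> : (Some (turn (~~ c) j), None) = f (rim (~~ c) j) by rewrite stepE sgE eqxx.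
have [e _ _] := sgP j.
have -> : rim (~~ c) j = f (None, Some j) by rewrite /f /face_step /= e sgE.
by do 3![apply: connect_trans (fconnect1 _ _) _].
Qed.

End Wheel.

(** * Merging three faces at a vertex *)

Lemma tperm_mul_coarser (T : finType) (s : {perm T}) x y u v :
  x \notin porbit s y -> v \in porbit s u -> v \in porbit (tperm x y * s)%g u.
Proof.
move=> xy vu; have [ex ey] := tperm_mul_join xy.
have [uU|] := boolP (u \in porbit s x :|: porbit s y).
  have U w : w \in porbit s x :|: porbit s y ->
      porbit (tperm x y * s) w = porbit s x :|: porbit s y.
    by rewrite -{1}ex => /porbit_eqP ->.
  rewrite U //; move: uU; rewrite !inE => /orP[] uU.
    by rewrite (porbit_trans vu uU).
  by rewrite (porbit_trans vu uU) orbT.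
by rewrite inE negb_or => /andP[ux uy]; rewrite tperm_mul_other.
Qed.

(** A single exchange of corners would break the rotation at [c] into two cycles; a second one,
    sharing a corner with it, rejoins them. Each exchange fuses two faces, so two orbits are lost
    and the genus rises by one. *)
Lemma rotation_merge3 (G : sgraph) (P : G -> {perm G}) (c x y z : G) :
  rotation (@adj G) P -> [/\ adj c x, adj c y & adj c z] ->
  let face u := porbit (facep P) (u, c) in
  [/\ face x != face y, face x != face z & face y != face z] ->
  exists P' : G -> {perm G},
    [/\ rotation (@adj G) P', #|porbits (facep P')|.+2 = #|porbits (facep P)|,
      forall d d', d' \in porbit (facep P) d -> d' \in porbit (facep P') d,
      (y, c) \in porbit (facep P') (x, c) & (z, c) \in porbit (facep P') (x, c)].
Proof.
move=> rP [cx cy cz] /= [].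
(* One of the two cyclic exchanges of the corners at [x], [y], [z] leaves the
   rotation around [c] a single cycle; which one depends on their order. *)
wlog zx : x y cx cy / z \in porbit (tperm x y * P c)%g x.
  move=> IH fxy fxz fyz; have [zx|zx] := boolP (z \in porbit (tperm x y * P c)%g x).
    exact: (IH x y).
  have [||||||P' [rP' nP' sub xP' zP']] := IH y x; rewrite // 1?eq_sym //.
    have [cyc _] := rP c.
    have xy : x != y by apply: contraNneq fxy => ->.
    have xPy : x \in porbit (P c) y by rewrite cyc !inE.
    have [U _] := tperm_mul_split xy xPy.
    have : z \in porbit (P c) x by rewrite cyc !inE.
    by rewrite -U inE (negPf zx) tpermC.
  exists P'; split=> //; first by rewrite porbit_sym.
  by apply: porbit_trans zP' _; rewrite porbit_sym.
rewrite !eq_porbit_mem => fxy fxz fyz.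
have [cyc fix_c] := rP c; set A := [set _ | _] in cyc fix_c.
have xy : x != y by apply: contraNneq fxy => ->; apply: porbit_id.
have yz : y != z by apply: contraNneq fyz => ->; apply: porbit_id.
have xPy : x \in porbit (P c) y by rewrite cyc !inE.
have [U nU] := tperm_mul_split xy xPy; set s1 := (tperm x y * P c)%g in U nU zx.
have yz1 : y \notin porbit s1 z.
  by apply: contra nU => yz'; rewrite porbit_sym; apply: porbit_trans yz' zx.
have cN u : adj c u -> c != u by apply: contraTneq => <-; rewrite adj_irrefl.
(* The last argument [c] makes the transposition at the other end trivial, so only the rotation at
   [c] changes. *)
pose P1 := twist P c x y c; pose P' := twist P1 c y z c.
have P1c : P1 c = s1 by rewrite /P1 /twist eqxx.
have P'c : P' c = (tperm y z * s1)%g by rewrite /P' /twist eqxx P1c.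
have P'u u : u != c -> P' u = P u.
  have keep Q a b : u != c -> twist Q c a b c u = Q u.
    move=> uc; rewrite /twist (negPf uc).
    by case: eqP => [->|//]; rewrite tperm1 mul1g.
  by move=> uc; rewrite /P' /P1 !keep.
have f1 : facep P1 = (tperm (x, c) (y, c) * facep P)%g.
  by rewrite facep_twist ?cN // tperm1 mul1g.
have f' : facep P' = (tperm (y, c) (z, c) * facep P1)%g.
  by rewrite facep_twist ?cN // tperm1 mul1g.
have fzx : (z, c) \notin porbit (facep P) (x, c) by rewrite porbit_sym.
have fzy : (z, c) \notin porbit (facep P) (y, c) by rewrite porbit_sym.
have yz_1 : (y, c) \notin porbit (facep P1) (z, c).
  by rewrite f1 (tperm_mul_other fzx fzy).
have sub d d' : d' \in porbit (facep P) d -> d' \in porbit (facep P') d.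
  by move=> h; rewrite f'; apply: tperm_mul_coarser => //; rewrite f1; apply: tperm_mul_coarser.
have [e1 e1'] := tperm_mul_join fxy; rewrite -f1 in e1 e1'.
have [e2 e2'] := tperm_mul_join yz_1; rewrite -f' in e2 e2'.
have xy' : (x, c) \in porbit (facep P') (y, c) by rewrite e2 e1' !inE porbit_id.
exists P'; split=> //.
- move=> u; have [->|uc] := eqVneq u c; last by rewrite P'u.
  rewrite P'c -/A; have [ey ez] := tperm_mul_join yz1; split=> [v vA|v vA].
    have AU : A = porbit s1 y :|: porbit s1 z.
      by rewrite setUC (porbit_eqP _ _ _ zx) U cyc ?inE.
    by rewrite AU -ey in vA *; apply/porbit_eqP.
  have vN w : w \in A -> w != v by apply: contraTneq => ->.
  have inA w : adj c w -> w \in A by rewrite inE.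
  by rewrite !permM !tpermD ?fix_c //; apply/vN/inA.
- by rewrite f' card_porbits_join // f1 card_porbits_join.
- by rewrite porbit_sym.
- have zy' : (z, c) \in porbit (facep P') (y, c) by rewrite e2 inE porbit_id orbT.
  by rewrite (porbit_eqP _ _ _ xy').
Qed.

(** * From faces of the base graph to embeddings with the new vertex, and back *)

Section CommonFace.
Variables (G : sgraph) (k : edge G -> nat).
Implicit Types (P : G -> {perm G}) (v : subdivision k).

Lemma on_face_sub P P' d d' v :
  (forall e, fconnect (face_step P) d e -> fconnect (face_step P') d' e) ->
  on_face P d v -> on_face P' d' v.
Proof.
move=> sub; case: v => [x [y h]|s [h|h]]; first by exists y; apply: sub.
  by left; apply: sub.
by right; apply: sub.
Qed.

(** With [P'] inverse to [P] on neighbours, each face is traced backwards through the reversed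
    darts. *)
Lemma on_face_mirror P P' d v : rotation_system P -> d \in dart G ->
  (forall x y, adj x y -> P' x (P x y) = y) ->
  on_face P d v -> on_face P' (swap d) v.
Proof.
move=> rP dG mir.
have sub e : fconnect (face_step P) d e -> fconnect (face_step P') (swap d) (swap e).
  move=> /iter_findex; move: (findex _ _ _) => i; elim: i e => [e <-|i IH e].
    exact: connect0.
  rewrite iterS => <-; set d1 := iter _ _ _.
  have d1G : d1 \in dart G by rewrite /d1; elim: (i) => //= m Hm; rewrite face_step_dart.
  apply: connect_trans (IH d1 erefl) _; rewrite face_step_sym.
  case: (d1) d1G => x y; rewrite inE /= => xy.
  have -> : swap (x, y) = face_step P' (swap (face_step P (x, y))).
    by rewrite /swap /face_step /= mir // adj_sym.
  exact: fconnect1.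
case: v => [x [y h]|s [h|h]].
- exists (P' x y); apply: connect_trans (sub _ h) _.
  by rewrite [(x, P' x y)](_ : _ = face_step P' (swap (x, y))) ?fconnect1.
- by right; apply: sub h.
- by left; move: (sub _ h); rewrite /swap /= -surjective_pairing.
Qed.

Lemma embedding_cofacial P g (v1 v2 v3 : subdivision k) :
  embedding P g -> [/\ v1 != v2, v1 != v3 & v2 != v3] -> on_common_face P v1 v2 v3 ->
  exists rho : add_vertex [set v1; v2; v3] -> {perm add_vertex [set v1; v2; v3]},
    embedding rho g.
Proof.
move=> [cG rP eul] v123 [d [dG o1 o2 o3]].
have [rho rr lift] := rotation_lift k rP.
have rs := rotation_rotation_system rr.
(* [on_faceP] yields a dart leaving [v]; its predecessor in the face is the arriving dart that names
   the corner. *)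
have before v : on_face P d v -> exists2 p, adj v p &
    fconnect (face_step rho) (first_dart k d) (p, v).
  move=> /(on_faceP rP rs lift _ dG)[b vb h].
  pose p := ((rho v)^-1 b)%g.
  have e : face_step rho (p, v) = (v, b) by rewrite /face_step /= permKV.
  have : (p, v) \in dart (subdivision k) by rewrite -(face_step_dart _ rs) e.
  rewrite inE adj_sym => vp; exists p => //.
  apply: connect_trans h _; rewrite (@face_step_sym _ rho) -e.
  exact: fconnect1.
have [p1 vp1 h1] := before _ o1; have [p2 vp2 h2] := before _ o2.
have [p3 vp3 h3] := before _ o3.
have link q q' : fconnect (face_step rho) (first_dart k d) q ->
    fconnect (face_step rho) (first_dart k d) q' -> fconnect (face_step rho) q q'.
  by move=> hq; rewrite (@face_step_sym _ rho) in hq; apply: connect_trans.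
have eulH : #|subdivision k| + fcard (face_step rho) (dart (subdivision k)) + 2 * g =
    #|edge (subdivision k)| + 2.
  rewrite (fcard_lift rP rs lift); have := card_subdivision k.
  by move: eul; clear; lia.
exact: (embedding_add_vertex v123 (connected_subdivision cG) rr eulH
  (And3 vp1 vp2 vp3) (link _ _ h1 h2) (link _ _ h1 h3)).
Qed.

Lemma embedding_forget (v1 v2 v3 : subdivision k)
    (rho : add_vertex [set v1; v2; v3] -> {perm add_vertex [set v1; v2; v3]}) :
  (forall x, exists y, @adj G x y) -> [/\ v1 != v2, v1 != v3 & v2 != v3] ->
  embedding rho 0 ->
  exists P, [/\ rotation_system P,
    #|edge G| + 2 <= #|G| + fcard (face_step P) (dart G) &
    #|G| + fcard (face_step P) (dart G) <= #|edge G| + 2 -> on_common_face P v1 v2 v3].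
Proof.
move=> nbr v123 emb.
have nbrH v : exists u, @adj (subdivision k) v u.
  case: v => [x|s]; first by have [y xy] := nbr x; exists (sub_next k x y); apply: sub_next_nbr.
  exists (sub_pt k (tag s) (nat_of_ord (tagged s)).+2).
  by rewrite [inr s]sub_ptS; apply/sub_adj_pt/ltn_ord.
have [rho0 [rr le cof]] := embedding_remove_vertex v123 nbrH emb.
have rs := rotation_rotation_system rr.
have [P rP lift] := rotation_unlift rs.
have rPs := rotation_rotation_system rP; have cS := card_subdivision k.
exists P; rewrite -(fcard_lift rPs rs lift); split=> //.
  by move: le cS; clear; lia.
move=> le'; have {cof} [|p1 [p2 [p3 [vp1 vp2 vp3 h1 h2]]]] := cof.
  by move: le' cS; clear; lia.
have p3H : (p3, v3) \in dart (subdivision k) by rewrite inE adj_sym.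
have dG := sub_dart_dart p3H; have dF := fconnect_first_dart rs p3H.
have on v p : adj v p -> fconnect (face_step rho0) (p3, v3) (p, v) ->
    on_face P (sub_dart (p3, v3)) v.
  move=> vp h; apply/(on_faceP rPs rs lift _ dG); exists (rho0 v p).
    by rewrite (rotation_adj _ _ rr).
  exact: connect_trans dF (connect_trans h (fconnect1 (face_step rho0) (p, v))).
exists (sub_dart (p3, v3)); split=> //; first exact: on h1.
  exact: on h2.
by apply: (on _ p3) => //; apply: connect0.
Qed.

End CommonFace.

(** The triangles chosen for the three antennal vertices may coincide, while merging takes three
    distinct faces; the choice is filled up accordingly. *)
Lemma cover3 (T : finType) (i1 i2 i3 : T) : 2 < #|T| ->
  exists j1 j2 j3 : T, [/\ j1 != j2, j1 != j3 & j2 != j3] /\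
    {subset [:: i1; i2; i3] <= [:: j1; j2; j3]}.
Proof.
move=> T3.
have fresh (x y : T) : exists z, (x != z) && (y != z).
  have /set0Pn[z] : ~: [set x; y] != set0.
    rewrite -card_gt0 cardsCs setCK subn_gt0 (leq_ltn_trans _ T3) //.
    by rewrite cards2; case: (x != y).
  by rewrite !inE negb_or ![z == _]eq_sym; exists z.
have distinct (x y : T) : exists j2 j3, [/\ x != j2, x != j3 & j2 != j3] /\
    y \in [:: x; j2; j3].
  have [->|xy] := eqVneq x y.
    have [j2 /andP[y2 _]] := fresh y y; have [j3 /andP[y3 j23]] := fresh y j2.
    by exists j2, j3; rewrite mem_head.
  have [j3 /andP[x3 y3]] := fresh x y.
  by exists y, j3; rewrite !inE eqxx orbT.
have [e12|n12] := eqVneq i1 i2.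
  have [j2 [j3 [d m3]]] := distinct i1 i3; exists i1, j2, j3; split=> // u.
  by rewrite !inE -e12 orbA orbb => /orP[->//|/eqP->]; rewrite !inE in m3.
have [e3|] := boolP (i3 \in [:: i1; i2]).
  have [j3 /andP[x3 y3]] := fresh i1 i2; exists i1, i2, j3; split=> // u.
  by rewrite !inE in e3 *; case/or3P=> /eqP-> //; rewrite ?eqxx ?orbT // orbA e3.
rewrite !inE negb_or ![i3 == _]eq_sym => /andP[n13 n23].
by exists i1, i2, i3; split=> //; split.
Qed.

(** * Planar and toroidal embeddings of the wheel *)

Section WheelGenus.
Variable n : nat.
Hypothesis hn : 3 <= n.
Local Notation W := (wheel n).

Lemma card_wheel : #|W| = n.+1.
Proof. by rewrite card_option card_ord. Qed.

Lemma wheel_nbr x : exists y, @adj W x y.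
Proof.
case: x => [i|]; first by exists None.
by exists (Some (Ordinal (ltn_trans (isT : 0 < 2) hn))).
Qed.

Lemma wheel_sign_agree (P P' : W -> {perm W}) b :
  (forall i, wheel_sign P b i) -> (forall i, P None (Some (turn b i)) = Some i) ->
  (forall i, wheel_sign P' b i) -> (forall i, P' None (Some (turn b i)) = Some i) ->
  forall x y, @adj W x y -> P' x y = P x y.
Proof.
move=> sP cP sP' cP' [i|] y.
  have [e1 e2 e3] := sP i; have [e1' e2' e3'] := sP' i.
  have /setP/(_ y) := wheel_nbrs hn i b; rewrite !inE => -> /orP[/orP[]|] /eqP->.
  - by rewrite e1 e1'.
  - by rewrite e2 e2'.
  - by rewrite e3 e3'.
case: y => [j|] //= _.
by rewrite -[j](turnK (~~ b)) negbK cP cP'.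
Qed.

Lemma wheel_sign_mirror (P P' : W -> {perm W}) b :
  (forall i, wheel_sign P b i) -> (forall i, P None (Some (turn b i)) = Some i) ->
  (forall i, wheel_sign P' (~~ b) i) -> (forall i, P' None (Some (turn (~~ b) i)) = Some i) ->
  forall x y, @adj W x y -> P' x (P x y) = y.
Proof.
move=> sP cP sP' cP' [i|] y.
  have [e1 e2 e3] := sP i; have [e1' e2' e3'] := sP' i; rewrite negbK in e2' e3'.
  have /setP/(_ y) := wheel_nbrs hn i b; rewrite !inE => -> /orP[/orP[]|] /eqP->.
  - by rewrite e1 e3'.
  - by rewrite e2 e2'.
  - by rewrite e3 e1'.
case: y => [j|] //= _.
rewrite -{1}[j](turnK (~~ b)) negbK cP; exact: cP'.
Qed.

(** This is uniqueness of the planar embedding up to reflection: the signs of [P] and [P'] agree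
    everywhere or differ everywhere, and a reflection merely reverses the faces. *)
Lemma wheel_common_face P P' (k : edge W -> nat) (v1 v2 v3 : subdivision k) :
  rotation_system P -> rotation_system P' ->
  n < fcard (face_step P) (dart W) -> n < fcard (face_step P') (dart W) ->
  on_common_face P' v1 v2 v3 -> on_common_face P v1 v2 v3.
Proof.
move=> rP rP' /(wheel_rigid hn rP)[_ [b [sP cP _]]].
move=> /(wheel_rigid hn rP')[_ [b' [sP' cP' _]]].
case=> d [dG o1 o2 o3]; have [e|ne] := eqVneq b b'.
  rewrite -{b'}e in sP' cP'.
  have sub u : fconnect (face_step P') d u -> fconnect (face_step P) d u.
    by rewrite (fconnect_agree rP (wheel_sign_agree sP cP sP' cP') _ dG).
  by exists d; split=> //; apply: on_face_sub sub _.
have {ne}e : b = ~~ b' by move: ne; case: (b); case: (b').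
rewrite {b}e in sP cP.
have mir := wheel_sign_mirror sP' cP' sP cP.
exists (swap d); split; first by case: d dG {o1 o2 o3} => x y; rewrite !inE adj_sym.
- exact: on_face_mirror o1.
- exact: on_face_mirror o2.
- exact: on_face_mirror o3.
Qed.

Lemma on_centre_face P b (k : edge W -> nat) (v : subdivision k) :
  (forall i, wheel_sign P b i) -> exists i : 'I_n, on_face P (None, Some i) v.
Proof.
move=> sP; case: v => [[i|]|s] /=.
- exists i, (Some (turn b i)); have [e _ _] := sP i.
  by rewrite -e; apply: (fconnect1 (face_step P) (None, Some i)).
- have [[i|] //] := wheel_nbr None; exists i, (Some i); exact: connect0.
have rim i : fconnect (face_step P) (None, Some i) (Some i, Some (turn b i)).
  by have [e _ _] := sP i; rewrite -e; apply: (fconnect1 (face_step P) (None, Some i)).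
have := @edge_adj W (tag s); rewrite /edge_on_face.
case: (val (tag s)) => -[i|] [j|] //= ij.
- have /setP/(_ (Some j)) := wheel_nbrs hn i b; rewrite !inE /= ij => /esym/orP[]/eqP[->].
    by exists i; left.
  (* A rim edge stored against direction [b] is traversed in reverse by the triangle of its other
     end. *)
  exists (turn (~~ b) i); right; have := rim (turn (~~ b) i).
  by have := turnK (~~ b) i; rewrite negbK => ->.
- by exists i; right; apply: connect0.
- by exists j; left; apply: connect0.
Qed.

Lemma wheel_torus (P : W -> {perm W}) (k : edge W -> nat) (v1 v2 v3 : subdivision k) :
  embedding P 0 ->
  exists2 P' : W -> {perm W}, embedding P' 1 & on_common_face P' v1 v2 v3.
Proof.
move=> [cW rP0 eul]; have [P1 rP agree] := rotation_normalize rP0.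
have rPs := rotation_rotation_system rP.
rewrite -(fcard_agree rP0 agree) in eul.
have lt : n < fcard (face_step P1) (dart W).
  by move: eul; rewrite card_wheel card_wheel_edge //; clear -hn; lia.
have [_ [b [sP cP inj]]] := wheel_rigid hn rPs lt.
have [i1 o1] := on_centre_face v1 sP; have [i2 o2] := on_centre_face v2 sP.
have [i3 o3] := on_centre_face v3 sP.
have [|j1 [j2 [j3 [[j12 j13 j23] sub]]]] := @cover3 _ i1 i2 i3; first by rewrite card_ord.
(* By [cP] the dart from [t j] into the centre continues to [Some j], so its corner lies on the
   triangle of [j]. *)
pose t j : W := Some (turn b j).
have tE j : facep P1 (t j, None) = (None, Some j) by rewrite facepE cP.
have fE j : porbit (facep P1) (t j, None) = porbit (facep P1) (None, Some j).
  by rewrite -tE porbit_step.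
have ft j j' : j != j' -> porbit (facep P1) (t j, None) != porbit (facep P1) (t j', None).
  rewrite !fE eq_porbit_mem porbit_sym -fconnect_face_step.
  by apply: contraNN => /inj ->.
have [||P' [rP' nP' coarse y' z']] := @rotation_merge3 W P1 None (t j1) (t j2) (t j3) rP.
- by [].
- by split; apply: ft.
have rPs' := rotation_rotation_system rP'.
exists P'.
  split=> //; have := card_edge_porbits rP; have := card_edge_porbits rP'.
  by move: eul nP'; clear; lia.
have cover i : i \in [:: j1; j2; j3] ->
    (None, Some i) \in porbit (facep P') (t j1, None).
  have tj j : (t j, None) \in porbit (facep P') (t j1, None) ->
      (None, Some j) \in porbit (facep P') (t j1, None).
    move=> h; apply: porbit_trans h; apply: coarse.
    by rewrite fE porbit_id.
  by rewrite !inE => /or3P[]/eqP->; apply: tj; rewrite ?porbit_id.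
exists (t j1, None); split=> //.
- apply: on_face_sub o1 => e; rewrite !fconnect_face_step => /coarse h.
  by apply: porbit_trans h _; apply/cover/sub; rewrite inE eqxx.
- apply: on_face_sub o2 => e; rewrite !fconnect_face_step => /coarse h.
  by apply: porbit_trans h _; apply/cover/sub; rewrite !inE eqxx orbT.
- apply: on_face_sub o3 => e; rewrite !fconnect_face_step => /coarse h.
  by apply: porbit_trans h _; apply/cover/sub; rewrite !inE eqxx !orbT.
Qed.

End WheelGenus.

Theorem theoremA (n : nat) (hn : 3 <= n)
    (* the planar embedding of the wheel *)
    (P : wheel n -> {perm wheel n}) (hP : embedding P 0)
    (* the wheel subdivided, and the three antennal vertices *)
    (k : edge (wheel n) -> nat) (v1 v2 v3 : subdivision k)
    (hdistinct : [/\ v1 <> v2, v1 <> v3 & v2 <> v3])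
    (* no other subdivision is performed *)
    (hsub : forall s : subdividing k, inr s \in [set v1; v2; v3]) :
  (on_common_face P v1 v2 v3 ->
     is_genus (add_vertex [set v1; v2; v3]) 0) /\
  (~ on_common_face P v1 v2 v3 ->
     is_genus (add_vertex [set v1; v2; v3]) 1).
Proof.
have v123 : [/\ v1 != v2, v1 != v3 & v2 != v3].
  by case: hdistinct => *; split; apply/eqP.
split=> [common|apart]; first by split=> //; apply: embedding_cofacial common.
(* Minimality of 1 amounts to excluding an embedding of genus 0. *)
split=> [|rho [|//] emb].
  by have [P' embP' common] := wheel_torus hn v1 v2 v3 hP; apply: embedding_cofacial common.
have [_ rP eul] := hP.
have [P' [rP' le cof]] := embedding_forget (wheel_nbr hn) v123 emb.
case: apart; move: eul le cof; rewrite card_wheel card_wheel_edge // => eul le cof.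
have lt : n < fcard (face_step P) (dart (wheel n)) by move: eul; clear; lia.
have lt' : n < fcard (face_step P') (dart (wheel n)) by move: le; clear; lia.
(* [P'] may differ from [P], but both have more than [n] faces, so they agree up to reflection. The
   exact count [n + 1] is the bound that [cof] awaits. *)
apply: (wheel_common_face hn rP rP' lt lt'); apply: cof.
by rewrite (wheel_rigid hn rP' lt').1; clear; lia.
Qed.
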